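(* For any Rademacher sum $X=\sum_{i=1}^na_i\varepsilon_i\in\mathcal{X}$, we have $\mathbb{P}(|X|\geq 1/\sqrt{5})\geq 29/64$.
   Context: $\mathcal{X}$ denotes the set of Rademacher sums $X=\sum_{i=1}^na_i\varepsilon_i$ where $a_1\geq a_2\geq\dots\geq a_n>0$ are real constants with $a_1^2+\dots+a_n^2=1$ (i.e. $\mathrm{Var}(X)=1$), and the $\varepsilon_i$ are independent random signs uniformly distributed on $\{-1,+1\}$. *)

(* Defs.v *)
From HB Require Import structures.
From mathcomp Require Import all_boot all_order all_algebra.
From mathcomp Require Import all_classical all_reals all_analysis.

Set Implicit Arguments.
Unset Strict Implicit.
Unset Printing Implicit Defensive.

Import Order.TTheory GRing.Theory Num.Theory.
Import numFieldNormedType.Exports.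

Local Open Scope classical_set_scope.
Local Open Scope ring_scope.

Section RademacherSums.
Context {R : realType} {d : measure_display} {T : measurableType d}.
Variable P : probability T R.

Definition mutually_independent (I : finType) (X : I -> {RV P >-> R}) : Prop :=
  forall (J : {set I}) (B : I -> set R),
    (forall i, i \in J -> measurable (B i)) ->
    P (\bigcap_(i in [set` J]) (X i @^-1` B i)) =
    (\prod_(i in J) P (X i @^-1` B i))%E.

Definition random_sign (X : {RV P >-> R}) : Prop :=
  P (X @^-1` [set 1]) = (2^-1)%:E /\ P (X @^-1` [set -1]) = (2^-1)%:E.

Definition rademacher_sum (n : nat) (a : 'I_n -> R)
    (eps : 'I_n -> {RV P >-> R}) : T -> R :=
  fun w => \sum_(i < n) a i * eps i w.

End RademacherSums.

(* Main.v *)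
Require Import Defs.
From HB Require Import structures.
From Stdlib Require Import ZArith.
From mathcomp Require Import all_boot all_order all_algebra.
From mathcomp Require Import all_classical all_reals all_analysis.
From mathcomp Require Import zify ssrZ ring lra.

(** Rescale the weights to [b1 >= b2 >= ...] with [sum b_i ^ 2 = 5 * 32 ^ 2]; the
    claim becomes [P (|sum +- b_i| < 32) <= 35 / 64]. If six weights are at least
    16, the window meets each symmetric chain of their signed sums at most twice,
    which gives [(20 + 15) / 64]. If [b4 >= 24], the chains of the four or five
    largest weights, reflection in the next weight and a damping estimate for the
    small ones suffice. Otherwise reflection shows that a walk which has left
    [(-32, 32)] ends inside with probability at most [1 / 2], so that it is enough
    to bound the probability of never leaving by [3 / 32]. The order of the steps
    is free: start at [b1], take the small steps first, each of which damps
    [cos (lam * x)] by [exp (- lam ^ 2 * b ^ 2 / 2)], and then the remaining large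
    ones, for which the surviving paths are counted. This reduces the claim to
    finitely many boxes for the largest weights, which are checked by integer
    arithmetic. *)

Set Implicit Arguments.
Unset Strict Implicit.
Unset Printing Implicit Defensive.

Import Order.TTheory GRing.Theory Num.Theory.
Import numFieldNormedType.Exports.

Local Open Scope classical_set_scope.
Local Open Scope ring_scope.

(** * Trigonometric bounds *)

Section Trigonometry.
Context {R : realType}.
Implicit Types x y z c : R.

Lemma ge0_derive_le (f f' : R -> R) x y :
  (forall z, is_derive z 1 f (f' z)) ->
  (forall z, x <= z <= y -> 0 <= f' z) -> x <= y -> f x <= f y.
Proof.
move=> df f'ge0 xy.
have dfz z : derivable f z 1 by case: (df z).
apply: (@ger0_derive1_ndecr _ _ x y) => // [z|].
  rewrite in_itv /= => /andP[xz zy].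
  by rewrite derive1E; case: (df z) => _ ->; rewrite f'ge0 // !ltW.
by apply: continuous_subspaceT => z; apply/differentiable_continuous/derivable1_diffP.
Qed.

(** Start from [cos <= 1] and integrate eight times from [0]. The factorials are kept as products of
    small numerals: [6! = 2 * 12 * 30], [8! = 2 * 12 * 30 * 56]. *)
Lemma cos_taylor_bounds x : 0 <= x ->
  1 - x ^+ 2 / 2 + x ^+ 4 / (2 * 12) - x ^+ 6 / (2 * 12 * 30) <= cos x <=
  1 - x ^+ 2 / 2 + x ^+ 4 / (2 * 12) - x ^+ 6 / (2 * 12 * 30)
    + x ^+ 8 / (2 * 12 * 30 * 56).
Proof.
pose step (f f' : R -> R) := forall y : R, is_derive y 1 f (f' y).
have integrate (f f' : R -> R) : step f f' -> f 0 = 0 ->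
    (forall y, 0 <= y -> 0 <= f' y) -> forall y, 0 <= y -> 0 <= f y.
  move=> df f0 f'ge0 y y0; rewrite -f0.
  by apply: (ge0_derive_le df) => // z /andP[z0 _]; exact: f'ge0.
have s1 y : 0 <= y -> 0 <= y - sin y.
  apply: (integrate (fun y => y - sin y) (fun y => 1 - cos y)).
  - by move=> z; apply: is_derive_eq.
  - by rewrite sin0 subr0.
  - by move=> z _; rewrite subr_ge0 cos_le1.
have c2 y : 0 <= y -> 0 <= cos y - (1 - y ^+ 2 / 2).
  apply: (integrate (fun y => cos y - (1 - y ^+ 2 / 2)) (fun y => y - sin y)) => //.
  - by move=> z; apply: is_derive_eq; rewrite /GRing.scale /=; field.
  - by rewrite cos0; field.
have s3 y : 0 <= y -> 0 <= sin y - (y - y ^+ 3 / 6).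
  apply: (integrate (fun y => sin y - (y - y ^+ 3 / 6))
                    (fun y => cos y - (1 - y ^+ 2 / 2))) => //.
  - by move=> z; apply: is_derive_eq; rewrite /GRing.scale /=; field.
  - by rewrite sin0; field.
have c4 y : 0 <= y -> 0 <= 1 - y ^+ 2 / 2 + y ^+ 4 / 24 - cos y.
  apply: (integrate (fun y => 1 - y ^+ 2 / 2 + y ^+ 4 / 24 - cos y)
                    (fun y => sin y - (y - y ^+ 3 / 6))) => //.
  - by move=> z; apply: is_derive_eq; rewrite /GRing.scale /=; field.
  - by rewrite cos0; field.
have s5 y : 0 <= y -> 0 <= y - y ^+ 3 / 6 + y ^+ 5 / (6 * 20) - sin y.
  apply: (integrate (fun y => y - y ^+ 3 / 6 + y ^+ 5 / (6 * 20) - sin y)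
                    (fun y => 1 - y ^+ 2 / 2 + y ^+ 4 / 24 - cos y)) => //.
  - by move=> z; apply: is_derive_eq; rewrite /GRing.scale /=; field.
  - by rewrite sin0; field.
have c6 y : 0 <= y ->
    0 <= cos y - (1 - y ^+ 2 / 2 + y ^+ 4 / (2 * 12) - y ^+ 6 / (2 * 12 * 30)).
  apply: (integrate (fun y => cos y - (1 - y ^+ 2 / 2 + y ^+ 4 / (2 * 12) - y ^+ 6 / (2 * 12 * 30)))
                    (fun y => y - y ^+ 3 / 6 + y ^+ 5 / (6 * 20) - sin y)) => //.
  - by move=> z; apply: is_derive_eq; rewrite /GRing.scale /=; field.
  - by rewrite cos0; field.
have s7 y : 0 <= y ->
    0 <= sin y - (y - y ^+ 3 / 6 + y ^+ 5 / (6 * 20) - y ^+ 7 / (6 * 20 * 42)).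
  apply: (integrate (fun y => sin y - (y - y ^+ 3 / 6 + y ^+ 5 / (6 * 20) - y ^+ 7 / (6 * 20 * 42)))
     (fun y => cos y - (1 - y ^+ 2 / 2 + y ^+ 4 / (2 * 12) - y ^+ 6 / (2 * 12 * 30)))) => //.
  - by move=> z; apply: is_derive_eq; rewrite /GRing.scale /=; field.
  - by rewrite sin0; field.
have c8 y : 0 <= y ->
    0 <= 1 - y ^+ 2 / 2 + y ^+ 4 / (2 * 12) - y ^+ 6 / (2 * 12 * 30)
           + y ^+ 8 / (2 * 12 * 30 * 56) - cos y.
  apply: (integrate (fun y => 1 - y ^+ 2 / 2 + y ^+ 4 / (2 * 12) - y ^+ 6 / (2 * 12 * 30)
           + y ^+ 8 / (2 * 12 * 30 * 56) - cos y)
     (fun y => sin y - (y - y ^+ 3 / 6 + y ^+ 5 / (6 * 20) - y ^+ 7 / (6 * 20 * 42)))) => //.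
  - by move=> z; apply: is_derive_eq; rewrite /GRing.scale /=; field.
  - by rewrite cos0; field.
by move=> x0; rewrite -subr_ge0 c6 //= -subr_ge0 c8.
Qed.

(** The derivative has the sign of [z * cos z - sin z], which vanishes at [0] and itself has
    derivative [- z * sin z <= 0] on [[0, 2]]. *)
Lemma cos_mul_expR_nincr x y : 0 <= x -> x <= y -> y <= 2 ->
  cos y * expR (y ^+ 2 / 2) <= cos x * expR (x ^+ 2 / 2).
Proof.
move=> x0 xy y2; rewrite -lerN2.
have sin_ge z : 0 <= z <= 2 -> z * cos z <= sin z.
  case/andP=> z0 z2.
  have := @ge0_derive_le (fun z => sin z - z * cos z) (fun z => z * sin z) 0 z.
  rewrite sin0 mul0r subrr subr_ge0; apply=> // [u|u /andP[u0 uz]].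
    by apply: is_derive_eq; rewrite /GRing.scale /=; ring.
  by rewrite mulr_ge0 // sin_ge0_pi // u0 (le_trans uz) // (le_trans z2) // pi_ge2.
apply: (@ge0_derive_le (fun z => - (cos z * expR (z ^+ 2 / 2)))
   (fun z => (sin z - z * cos z) * expR (z ^+ 2 / 2))) => // [z|z /andP[xz zy]].
  by apply: is_derive_eq; rewrite /GRing.scale /=; field.
by rewrite mulr_ge0 ?expR_ge0 // subr_ge0 sin_ge // (le_trans x0) //= (le_trans zy).
Qed.

Lemma cos_le_expR x : `|x| <= 2 -> cos x <= expR (- (x ^+ 2 / 2)).
Proof.
rewrite -cos_norm -real_normK ?num_real // => x2.
have := @cos_mul_expR_nincr 0 `|x| (lexx _) (normr_ge0 _) x2.
by rewrite cos0 expr0n mul0r expR0 mulr1 expRN -ler_pdivlMr ?expR_gt0 // mul1r.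
Qed.

(* [1569 / 1000] is a rational just below [pi / 2]. *)
Lemma cos_ge0_rat x : 1000 * `|x| <= 1569 -> 0 <= cos x.
Proof.
rewrite -cos_norm; have := normr_ge0 x; move: `|x| => {}x x0 xle.
apply: le_trans (andP (cos_taylor_bounds x0)).1.
(* [1.569 ^ 2 = 2.461761], and the Taylor polynomial in [x ^ 2] is still positive at [2.462]. *)
have x2 : x ^+ 2 <= 2462 / 1000 by nra.
have x20 : 0 <= x ^+ 2 by rewrite sqr_ge0.
have -> : x ^+ 4 = (x ^+ 2) ^+ 2 by rewrite -exprM.
have -> : x ^+ 6 = (x ^+ 2) ^+ 3 by rewrite -exprM.
move: (x ^+ 2) x2 x20 => y y1 y0.
have : 0 <= y ^+ 2 * (2462 / 1000 - y) by rewrite mulr_ge0 ?sqr_ge0 ?subr_ge0.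
nra.
Qed.

End Trigonometry.
(** * Averages over signs *)

Section SignAverages.
Context {R : realType}.
Implicit Types (f g : R -> R) (s t : seq R) (b x z : R).

(** The expectation of [f] at the end of a walk from [x] with independent fair steps of sizes
    [s]. *)
Fixpoint avg f s x : R :=
  if s is b :: s' then (avg f s' (x + b) + avg f s' (x - b)) / 2 else f x.

Lemma avg_cat f s t x : avg f (s ++ t) x = avg (avg f t) s x.
Proof. by elim: s x => //= b s IH x; rewrite !IH. Qed.

Lemma avg_move f s t b x : avg f (s ++ b :: t) x = avg f (b :: s ++ t) x.
Proof.
elim: s x => //= c s IH x; rewrite !IH /=.
rewrite (addrAC x b c) (addrAC x b (- c)) (addrAC x (- b) c) (addrAC x (- b) (- c)).
by field.
Qed.

Lemma avg_perm f s t x : perm_eq s t -> avg f s x = avg f t x.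
Proof.
elim: s t x => [|b s IH] t x; first by rewrite perm_sym => /perm_nilP->.
move=> bst; have bt : b \in t by rewrite -(perm_mem bst) mem_head.
case/path.splitPr: {t}bt bst => t1 t2 bst.
have st : perm_eq s (t1 ++ t2).
  by rewrite -(perm_cons b) (perm_trans bst) //; exact: (permEl (perm_catCA t1 [:: b] t2)).
by rewrite avg_move /= !(IH _ _ st).
Qed.

Lemma le_avg f g s x : (forall z, f z <= g z) -> avg f s x <= avg g s x.
Proof.
move=> fg; elim: s x => //= b s IH x.
by rewrite ler_pM2r ?invr_gt0 // lerD.
Qed.

Lemma avg_cst c s x : avg (fun=> c) s x = c.
Proof. by elim: s x => //= b s IH x; rewrite !IH; field. Qed.

Lemma avg_le_cst f c s x : (forall z, f z <= c) -> avg f s x <= c.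
Proof. by move=> fc; rewrite -[leRHS](avg_cst c s x); exact: le_avg. Qed.

Lemma avg_even f s x : (forall z, f (- z) = f z) -> avg f s (- x) = avg f s x.
Proof.
move=> fN; elim: s x => //= b s IH x.
have -> : - x + b = - (x - b) by ring.
have -> : - x - b = - (x + b) by ring.
by rewrite !IH addrC.
Qed.

(** By symmetry the sign of one step may be frozen, so any weight can serve as the starting
    point. *)
Lemma avg_start f s x : (forall z, f (- z) = f z) ->
  avg f (x :: s) 0 = avg f s x.
Proof. by move=> fN /=; rewrite add0r sub0r avg_even //; field. Qed.

(* Reflection: averaging over the sign of the starting point turns the value
   at [x] into a pair of values of [f] at distance [x] from a common centre. *)
Lemma avg_le_reflect f s A x : (forall z, f (- z) = f z) ->
  (forall z, f (z + x) + f (z - x) <= 2 * A) -> avg f s x <= A.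
Proof.
move=> fN fA; rewrite -avg_start // -[x :: s]cat1s (avg_perm _ _ (t := s ++ [:: x])).
  rewrite avg_cat; apply: avg_le_cst => z /=.
  by rewrite ler_pdivrMr // mulrC.
by rewrite perm_catC.
Qed.

(** Both points take the same step, so they keep their distance and only the centre [z] moves. *)
Lemma avg_reflect_stable f s A x :
  (forall z, f (z + x) + f (z - x) <= 2 * A) ->
  forall z, avg f s (z + x) + avg f s (z - x) <= 2 * A.
Proof.
move=> fA; elim: s => //= b s IH z.
have := IH (z + b); have := IH (z - b); rewrite !(addrAC _ _ x) !(addrAC _ _ (- x)).
lra.
Qed.

Lemma sumr_sqr_ge0 s : 0 <= \sum_(b <- s) b ^+ 2.
Proof. by apply: sumr_ge0 => b _; exact: sqr_ge0. Qed.

(* Stop the walk when it leaves [(-delta, delta)]: there the reflection bound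
   applies, and before that [K cos (lam x)] is damped by every step. *)
Lemma avg_tail f A K lam delta m s x :
  (forall z, f (- z) = f z) ->
  (forall w z, delta <= w <= delta + m -> f (z + w) + f (z - w) <= 2 * A) ->
  (forall z, `|z| < delta -> f z <= A + K * cos (lam * z)) ->
  0 <= K -> 0 <= lam -> 1000 * (lam * (delta + m)) <= 1569 ->
  (forall b, b \in s -> 0 <= b <= m) -> `|x| < delta ->
  avg f s x <= A + K * cos (lam * x) * expR (- (lam ^+ 2 / 2) * \sum_(b <- s) b ^+ 2).
Proof.
move=> fN fA fin K0 lam0 lamd.
elim: s x => [|b s IH] x bs xd.
  by rewrite /= big_nil mulr0 expR0 mulr1 fin.
have d0 : 0 < delta by apply: le_lt_trans xd.
have /andP[b0 bm] : 0 <= b <= m by apply: bs; rewrite mem_head.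
set e := expR (- (lam ^+ 2 / 2) * \sum_(c <- s) c ^+ 2).
have e0 : 0 <= e by rewrite expR_ge0.
have cosy y : `|y| <= delta + m -> 0 <= cos (lam * y).
  move=> ym; apply: cos_ge0_rat; rewrite normrM (ger0_norm lam0).
  have : lam * `|y| <= lam * (delta + m) by rewrite ler_wpM2l.
  by move: lamd; lra.
have step y : `|y| < delta + m -> avg f s y <= A + K * cos (lam * y) * e.
  move=> ym; case: (ltP `|y| delta) => [yd|dy].
    by apply: IH => // c cs; apply: bs; rewrite inE cs orbT.
  (* The walk has just left. Reflection gives [A], and the cosine term is nonnegative because the
     overshoot is less than [m]. *)
  apply: (@le_trans _ _ A).
    have -> : avg f s y = avg f s `|y| by case: (ger0P y) => // _; rewrite avg_even.
    by apply: avg_le_reflect => // z; apply: fA; rewrite dy ltW.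
  rewrite lerDl; apply: mulr_ge0 => //; apply: mulr_ge0 => //; exact/cosy/ltW.
have x1 : `|x + b| < delta + m.
  by rewrite (le_lt_trans (ler_normD _ _)) // (ger0_norm b0) ltr_leD.
have x2 : `|x - b| < delta + m.
  by rewrite (le_lt_trans (ler_normB _ _)) // (ger0_norm b0) ltr_leD.
rewrite /=; have := step _ x1; have := step _ x2.
rewrite big_cons (mulrDr (- (_ ^+ 2 / 2))) expRD -/e !mulrDr !mulrN cosB cosD.
set u := avg f s _; set v := avg f s _ => h1 h2.
(* By the addition formulas, averaging over the sign of [b] multiplies the cosine by
   [cos (lam * b)]. *)
have : cos (lam * b) <= expR (- (lam ^+ 2 / 2) * b ^+ 2).
  rewrite mulNr -mulrAC -exprMn cos_le_expR // normrM !ger0_norm //.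
  have : lam * b <= lam * (delta + m).
    by rewrite ler_wpM2l // (le_trans bm) // lerDr ltW.
  by move: lamd; lra.
set E := expR (_ * b ^+ 2) => cE.
have cx : 0 <= cos (lam * x).
  by apply: cosy; rewrite (le_trans (ltW xd)) // lerDl (le_trans b0).
have : K * cos (lam * x) * cos (lam * b) * e <= K * cos (lam * x) * E * e.
  by rewrite ler_wpM2r // ler_wpM2l // mulr_ge0.
nra.
Qed.

End SignAverages.
(** * Symmetric chains *)

Section SymmetricChains.
Context {R : realType}.
Implicit Types (w : R -> R) (s c : seq R) (b h x y z C M : R).

(* The de Bruijn - Tengbergen - Kruyswijk decomposition of the signed sums
   [x +- b1 +- ... +- bn] into chains whose steps are among the [2 * bi]. *)
Fixpoint chains s x : seq (seq R) :=
  if s is b :: s' then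
    flatten [seq if c is y :: c' then
                   let top := rcons [seq z - b | z <- c] (last y c' + b) in
                   if c' is [::] then [:: top]
                   else [:: top; [seq z + b | z <- belast y c']]
                 else [::] | c <- chains s' x]
  else [:: [:: x]].

(** The sizes do not depend on the weights. A singleton yields only one chain, as the shorter one
    would be empty. *)
Fixpoint chain_sizes n : seq nat :=
  if n is n'.+1 then
    flatten [seq if k == 1 then [:: 2] else [:: k.+1; k.-1] | k <- chain_sizes n']
  else [:: 1%N].

Lemma chains_neq0 s x c : c \in chains s x -> c != [::].
Proof.
elim: s c => [|b s IH] c /=; first by rewrite inE => /eqP->.
case/flatten_mapP=> -[//|y [|z c']] _ /=; first by rewrite inE => /eqP->.
by rewrite !inE => /orP[]/eqP->.
Qed.

Lemma size_chains s x : [seq size c | c <- chains s x] = chain_sizes (size s).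
Proof.
elim: s => //= b s <-; have := @chains_neq0 s x.
elim: (chains s x) => //= c cs IH neq0.
rewrite map_cat -IH => [|c' c'cs]; last by apply: neq0; rewrite inE c'cs orbT.
congr (_ ++ _); have := neq0 c (mem_head _ _).
case: c {neq0} => [//|y [|z c']] _ //=.
by rewrite size_rcons !size_map size_belast.
Qed.

Lemma avg_shift f s x b : avg f s (x + b) = avg (fun y => f (y + b)) s x.
Proof.
elim: s x => //= c s IH x.
by rewrite (addrAC x) (addrAC x b (- c)) !IH.
Qed.

(** The chains made from [c] together hold [y - b] and [y + b] for each [y] in [c], so the chains
    partition the signed sums. *)
Lemma sum_chains f s x :
  \sum_(c <- chains s x) \sum_(y <- c) f y = 2 ^+ size s * avg f s x.
Proof.
elim: s f => [|b s IH] f; first by rewrite /= !big_seq1 mul1r.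
have -> : 2 ^+ size (b :: s) * avg f (b :: s) x =
    2 ^+ size s * avg (fun y => f (y + b)) s x +
    2 ^+ size s * avg (fun y => f (y - b)) s x.
  by rewrite /= exprS !avg_shift; field.
rewrite -!IH -big_split /= big_flatten /= big_map.
apply: eq_big_seq => c /chains_neq0; case: c => [//|y c] _.
have -> : \sum_(z <- y :: c) f (z + b) =
    f (last y c + b) + \sum_(z <- belast y c) f (z + b).
  by rewrite lastI big_rcons /= addrC.
case: c => [|z c]; first by rewrite !big_seq1 /= big_cons big_seq1 big_nil; ring.
rewrite big_cons big_seq1 big_rcons !big_map /=; ring.
Qed.

(** The only new gap lies between the old last point shifted by [- b] and by [b]; the other gaps are
    inherited. *)
Lemma sorted_chains h s x : (forall b, b \in s -> h <= b) ->
  forall c, c \in chains s x -> sorted (fun y z => y + 2 * h <= z) c.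
Proof.
have shift c b : sorted (fun y z => y + 2 * h <= z) [seq z + b | z <- c] =
                 sorted (fun y z => y + 2 * h <= z) c.
  by rewrite sorted_map; apply: eq_sorted => y z /=; rewrite addrAC lerD2r.
elim: s => [|b s IH] hs c /=; first by rewrite inE => /eqP->.
have hb : h <= b by apply: hs; rewrite mem_head.
have {}IH c' : c' \in chains s x -> sorted (fun y z => y + 2 * h <= z) c'.
  by apply: IH => // b' b's; apply: hs; rewrite inE b's orbT.
case/flatten_mapP => -[//|y c'] /IH yc'.
have top : sorted (fun y z => y + 2 * h <= z)
    (rcons [seq z - b | z <- y :: c'] (last y c' + b)).
  rewrite /= rcons_path (last_map (fun z => z - b))
          -[path _ _ _]/(sorted _ [seq z - b | z <- y :: c']).
  by rewrite shift yc' /=; lra.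
have bot : sorted (fun y z => y + 2 * h <= z) [seq z + b | z <- belast y c'].
  by move: yc'; rewrite shift lastI -cats1 => /cat_sorted2[].
by case: c' {yc'} top bot => [|z c'] top bot; rewrite !inE; [move/eqP-> | case/orP=> /eqP->].
Qed.

(** Points two places apart in the chain differ by at least [4 * h], so at most two neighbours carry
    weight. *)
Lemma chain_weight_le w h C1 C c : 0 <= h ->
  (forall y z, y + 4 * h <= z -> w y = 0 \/ w z = 0) ->
  (forall y, w y <= C1) -> (forall y z, y + 2 * h <= z -> w y + w z <= C) ->
  C1 <= C -> c != [::] -> sorted (fun y z => y + 2 * h <= z) c ->
  \sum_(y <- c) w y <= if size c == 1%N then C1 else C.
Proof.
move=> h0 far w1 w2 C1C.
elim: c => [//|y [|z c] IH] _ yzc; first by rewrite big_seq1.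
case/andP: (yzc) => yz zc; have {}IH := IH isT zc.
have [wy0|wy0] := eqVneq (w y) 0.
  by rewrite big_cons wy0 add0r (le_trans IH) //; case: ifP.
rewrite !big_cons big1_seq ?addr0; first exact: w2.
move=> u /andP[_ uc].
have zu : z + 2 * h <= u.
  apply: (allP (order_path_min _ zc)) uc => a b' c'; lra.
by case: (far y u); [lra | move/eqP; rewrite (negPf wy0) |].
Qed.

Lemma avg_chains_le w h C1 C s x : 0 <= h ->
  (forall y z, y + 4 * h <= z -> w y = 0 \/ w z = 0) ->
  (forall y, w y <= C1) -> (forall y z, y + 2 * h <= z -> w y + w z <= C) ->
  C1 <= C -> (forall b, b \in s -> h <= b) ->
  2 ^+ size s * avg w s x <=
  \sum_(k <- chain_sizes (size s)) (if k == 1%N then C1 else C).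
Proof.
move=> h0 far w1 w2 C1C hs.
rewrite -sum_chains -(size_chains s x) big_map big_seq [leRHS]big_seq.
apply: ler_sum => c cs.
exact: chain_weight_le (chains_neq0 cs) (sorted_chains hs cs).
Qed.

Definition window M x : R := (`|x| < M)%R%:R.

Lemma windowN M x : window M (- x) = window M x.
Proof. by rewrite /window normrN. Qed.

Lemma window_le1 M x : window M x <= 1.
Proof. by rewrite lern1 leq_b1. Qed.

Lemma window_reflect M x z : M <= x -> window M (z + x) + window M (z - x) <= 1.
Proof.
move=> Mx; rewrite /window -natrD lern1.
case: (ltP `|z + x| M); case: (ltP `|z - x| M) => //.
by rewrite !ltr_norml; lra.
Qed.

Lemma avg_window_le M h s x : 0 <= h -> M <= 2 * h -> (forall b, b \in s -> h <= b) ->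
  2 ^+ size s * avg (window M) s x <=
  \sum_(k <- chain_sizes (size s)) (if k == 1%N then 1 else 2).
Proof.
move=> h0 Mh; apply: avg_chains_le => // [y z yz|y|y z _|].
- rewrite /window; case: (ltP `|y| M); case: (ltP `|z| M);
  rewrite ?ltr_norml => *; by [left | right | exfalso; lra].
- exact: window_le1.
- by rewrite -[leRHS]/(1 + 1); apply: lerD; exact: window_le1.
- by rewrite ler1n.
Qed.

(** Weigh a point by how many of the windows around [B] and [-B] contain it. Both windows lie in an
    interval of length [2 * (M + |B|) <= 4 * h], and their overlap has length at most [2 * h], so
    two neighbours never both have weight 2. *)
Lemma avg_window_pair_le M h B s z : 0 <= h -> M <= B + h -> B <= 2 * h - M ->
  (forall b, b \in s -> h <= b) ->
  2 ^+ size s * (avg (window M) s (z + B) + avg (window M) s (z - B)) <=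
  \sum_(k <- chain_sizes (size s)) (if k == 1%N then 2 else 3).
Proof.
move=> h0 MBh BhM hs.
have -> : avg (window M) s (z + B) + avg (window M) s (z - B) =
    avg (fun y => window M (y + B) + window M (y - B)) s z.
  rewrite !avg_shift; elim: s z {hs} => //= b s IH z.
  by rewrite -!IH; field.
apply: (avg_chains_le (h := h)) => // [u v uv|u|u v uv|].
- rewrite /window; case: (ltP `|u + B| M); case: (ltP `|u - B| M);
  case: (ltP `|v + B| M); case: (ltP `|v - B| M);
  rewrite ?addr0 ?ltr_norml ?ler_normr => *;
  by [left | right | exfalso; lra].
- by rewrite -[leRHS]/(1 + 1); apply: lerD; exact: window_le1.
- rewrite /window; case: (ltP `|u + B| M); case: (ltP `|u - B| M);
  case: (ltP `|v + B| M); case: (ltP `|v - B| M);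
  rewrite ?ltr_norml => * /=; rewrite ?mulr1n ?mulr0n; lra.
- by rewrite ler_nat.
Qed.

End SymmetricChains.
(** * Sequences with several large weights *)

Section LargeWeights.
Context {R : realType}.
Implicit Types (f : R -> R) (s t : seq R) (b h x y z A M : R).

Lemma avg_window_large_le M b s : M <= b -> avg (window M) (b :: s) 0 <= 1 / 2.
Proof.
move=> Mb; rewrite avg_start; last exact: windowN.
apply: avg_le_reflect => [|z]; first exact: windowN.
by have := window_reflect z Mb; lra.
Qed.

Lemma avg_window_six_le M s t : 0 <= M -> size s = 6 -> (forall b, b \in s -> M <= 2 * b) ->
  avg (window M) (s ++ t) 0 <= 35 / 64.
Proof.
move=> M0 s6 Ms; rewrite (avg_perm _ _ (t := t ++ s)) ?avg_cat; last by rewrite perm_catC.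
apply: avg_le_cst => z; have := @avg_window_le _ M (M / 2) s z.
rewrite s6 /= !big_cons big_nil /= => /(_ _ _ _)H.
suff : 2 ^+ 6 * avg (window M) s z <= 35 by lra.
by apply: le_trans (H _ _ _) _ => [||b /Ms|]; lra.
Qed.

(** This is [avg_tail] with [delta = m = d] and [lam * d = 39 / 50]. As [cos (39 / 50) >= 69 / 100],
    [K = kappa * 100 / 69] suffices; the factor [1 + 3 / 10 * c] comes from [exp u >= 1 + u] and
    [(39 / 50) ^ 2 / 2 >= 3 / 10]. *)
Lemma avg_tail_coarse f A kappa d c q t : (forall z, f (- z) = f z) ->
  (forall w z, d <= w <= 2 * d -> f (z + w) + f (z - w) <= 2 * A) ->
  (forall z, f z <= A + kappa) -> 0 <= kappa -> 0 < d -> 0 <= c ->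
  (forall b, b \in t -> 0 <= b <= d) -> c * d ^+ 2 <= \sum_(b <- t) b ^+ 2 ->
  1 <= q * (69 / 100 * (1 + 3 / 10 * c)) -> avg f t 0 <= A + kappa * q.
Proof.
move=> fN fA fk k0 d0 c0 td tc qc.
pose lam : R := 39 / (50 * d).
have lamd : lam * d = 39 / 50 by rewrite /lam; field; lra.
have lam0 : 0 <= lam by rewrite divr_ge0; lra.
have := @avg_tail R f A (kappa * (100 / 69)) lam d d t 0 fN.
rewrite mulr0 cos0 normr0 -mulr2n -[d *+ 2]mulr_natl => /(_ fA) tail.
apply: le_trans (tail _ _ _ _ _ _) _ => //; last 1 first.
- rewrite lerD2l mulr1 -mulrA; apply: ler_wpM2l => //.
  set v := \sum_(b <- t) b ^+ 2 in tc *.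
  have lamv : 3 / 10 * c <= lam ^+ 2 / 2 * v.
    have : lam ^+ 2 / 2 * (c * d ^+ 2) <= lam ^+ 2 / 2 * v.
      by rewrite ler_wpM2l // divr_ge0 // sqr_ge0.
    have -> : lam ^+ 2 / 2 * (c * d ^+ 2) = (lam * d) ^+ 2 / 2 * c by ring.
    by rewrite lamd; nra.
  rewrite mulNr expRN.
  have : 1 + 3 / 10 * c <= expR (lam ^+ 2 / 2 * v).
    by apply: le_trans (expR_ge1Dx _); lra.
  have := expR_gt0 (lam ^+ 2 / 2 * v); set e := expR _ => e0 ce.
  by rewrite ler_pdivrMr //; nra.
- move=> z zd; apply: (le_trans (fk z)); rewrite lerD2l -mulrA ler_peMr //.
  have z0 := normr_ge0 z.
  rewrite -cos_norm normrM (ger0_norm lam0).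
  have l1 : 0 <= lam * `|z| by rewrite mulr_ge0.
  have l2 : lam * `|z| <= 39 / 50 by rewrite -lamd ler_wpM2l // ltW.
  have [+ _] := andP (cos_taylor_bounds l1).
  have -> : (lam * `|z|) ^+ 4 = ((lam * `|z|) ^+ 2) ^+ 2 by rewrite -exprM.
  have -> : (lam * `|z|) ^+ 6 = ((lam * `|z|) ^+ 2) ^+ 3 by rewrite -exprM.
  have y1 : (lam * `|z|) ^+ 2 <= 61 / 100 by nra.
  have y0 : 0 <= (lam * `|z|) ^+ 2 by rewrite sqr_ge0.
  move: (_ ^+ 2) y1 y0 => y y1 y0.
  have : 0 <= y ^+ 2 * (61 / 100 - y) by rewrite mulr_ge0 ?sqr_ge0 ?subr_ge0.
  by have := sqr_ge0 y; rewrite -/(y ^+ 3); nra.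
- by rewrite mulr_ge0 //; lra.
- by rewrite (mulrCA lam) lamd; lra.
Qed.

(** If [3 * M <= 4 * h], the range of [w] contains [[M - h, 2 * (M - h)]], as [avg_tail_coarse]
    needs for [d = M - h]. This explains the threshold [3 / 4 * M]. *)
Lemma avg_bigs_pair_le M h s A :
  0 <= h -> (forall b, b \in s -> h <= b) ->
  \sum_(k <- chain_sizes (size s)) (if k == 1%N then 2 else 3) <= 2 ^+ size s * (2 * A) ->
  forall w z, M - h <= w -> w <= 2 * h - M ->
  avg (window M) s (z + w) + avg (window M) s (z - w) <= 2 * A.
Proof.
move=> h0 sh sA w z w1 w2.
have Mwh : M <= w + h by lra.
have p0 : 0 < 2 ^+ size s :> R by rewrite exprn_gt0.
rewrite -(ler_pM2l p0); exact: le_trans (avg_window_pair_le z h0 Mwh w2 sh) sA.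
Qed.

Lemma avg_window_insert M s t b :
  avg (window M) (s ++ b :: t) 0 = avg (avg (window M) s) t b.
Proof.
rewrite avg_move (avg_perm _ _ (t := b :: t ++ s)); last by rewrite perm_cons perm_catC.
by rewrite avg_start ?avg_cat //; exact: windowN.
Qed.

Lemma avg_window_cat M s t : avg (window M) (s ++ t) 0 = avg (avg (window M) s) t 0.
Proof. by rewrite (avg_perm _ _ (t := t ++ s)) ?avg_cat // perm_catC. Qed.

Lemma avg_windowN M s x : avg (window M) s (- x) = avg (window M) s x.
Proof. by apply: avg_even => z; exact: windowN. Qed.

(* Either the next weight falls in the range where reflection halves the chains
   of the large ones, or all remaining weights are at most [M - h]. *)
Lemma avg_window_fourth_le M b1 b2 b3 b4 b5 b6 t :
  0 < M -> b1 < M -> b2 <= b1 -> b3 <= b2 -> b4 <= b3 -> b5 <= b4 -> b6 <= b5 ->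
  3 * M <= 4 * b4 -> 2 * b6 < M -> (forall b, b \in t -> 0 <= b <= b6) -> 0 <= b6 ->
  \sum_(b <- [:: b1, b2, b3, b4, b5, b6 & t]) b ^+ 2 = 5 * M ^+ 2 ->
  avg (window M) [:: b1, b2, b3, b4, b5, b6 & t] 0 <= 35 / 64.
Proof.
move=> M0 b1M b21 b32 b43 b54 b65 b4M b6M tb b60.
rewrite !big_cons; set v := \sum_(b <- t) b ^+ 2 => sumM.
have sq x y : 0 <= x -> x <= y -> x ^+ 2 <= y ^+ 2 by move=> *; rewrite ler_sqr ?nnegrE; lra.
have q1 : b1 ^+ 2 <= M ^+ 2 by apply: sq; lra.
have q2 : b2 ^+ 2 <= M ^+ 2 by apply: sq; lra.
have q3 : b3 ^+ 2 <= M ^+ 2 by apply: sq; lra.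
pose s := [:: b1; b2; b3; b4].
have s4 : forall b, b \in s -> b4 <= b by move=> b; rewrite !inE => /or4P[]/eqP->; lra.
have s5 : forall b, b \in b5 :: s -> b5 <= b.
  by move=> b; rewrite inE => /orP[/eqP->|/s4]; lra.
have rest d : b6 <= d -> forall b, b \in b6 :: t -> 0 <= b <= d.
  move=> bd b; rewrite inE => /orP[/eqP->|/tb]; lra.
have perm5 r : avg (window M) [:: b1, b2, b3, b4, b5 & r] 0 =
               avg (window M) ((b5 :: s) ++ r) 0.
  rewrite -[[:: b1, b2, b3, b4, b5 & r]]/(s ++ b5 :: r).
  exact: avg_move.
case: (leP (3 * M) (4 * b5)) => [b5M|b5M].
  have A5 : forall w z, M - b5 <= w -> w <= 2 * b5 - M ->
     avg (window M) (b5 :: s) (z + w) + avg (window M) (b5 :: s) (z - w) <= 2 * (15 / 32).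
    apply: avg_bigs_pair_le => //; first by lra.
    by rewrite /= !big_cons big_nil /=; lra.
  (* Since [b6 < M / 2 <= 2 * b5 - M], the weight [b6] can only miss the reflecting range from
     below. *)
  case: (leP (M - b5) b6) => [b56|b56].
    rewrite perm5 avg_window_insert; apply: (@le_trans _ _ (15 / 32)); last by lra.
    apply: avg_le_reflect => z; first exact: avg_windowN.
    by apply: A5 => //; lra.
  (* The chain bound is [20 / 32 = 15 / 32 + 5 / 32]. The remaining squares sum to at least
     [M ^ 2 - b5 ^ 2 >= 7 * (M - b5) ^ 2], which is enough to halve the excess. *)
  rewrite perm5 avg_window_cat; have -> : 35 / 64 = 15 / 32 + 5 / 32 * (1 / 2) :> R by field.
  apply: (@avg_tail_coarse _ _ _ (M - b5) 7) => //; try lra.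
  - exact: avg_windowN.
  - by move=> w z /andP[w1 w2]; apply: A5 => //; lra.
  - move=> z; have := @avg_window_le _ M b5 (b5 :: s) z.
    rewrite /= !big_cons big_nil /= => /(_ _ _ s5)H.
    suff : 2 ^+ 5 * avg (window M) (b5 :: s) z <= 20 by rewrite /=; lra.
    by apply: le_trans (H _ _) _; lra.
  - by apply: rest; lra.
  - rewrite big_cons -/v.
    have q4 : b4 ^+ 2 <= M ^+ 2 by apply: sq; lra.
    nra.
have A4 : forall w z, M - b4 <= w -> w <= 2 * b4 - M ->
    avg (window M) s (z + w) + avg (window M) s (z - w) <= 2 * (1 / 2).
  apply: avg_bigs_pair_le => //; first by lra.
  by rewrite /= !big_cons big_nil /=; lra.
have m4 z : avg (window M) s z <= 1 / 2 + 1 / 8.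
  have := @avg_window_le _ M b4 s z.
  rewrite /= !big_cons big_nil /= => /(_ _ _ s4)H.
  suff : 2 ^+ 4 * avg (window M) s z <= 10 by rewrite /=; lra.
  by apply: le_trans (H _ _) _; lra.
have half : 1 / 2 <= 35 / 64 :> R by lra.
case: (leP (M - b4) b5) => [b45|b45]; last first.
  rewrite -[[:: b1, b2, b3, b4 & _]]/(s ++ [:: b5, b6 & t]) avg_window_cat.
  have -> : 35 / 64 = 1 / 2 + 1 / 8 * (3 / 8) :> R by field.
  apply: (@avg_tail_coarse _ _ _ (M - b4) 14) => //; try lra.
  - exact: avg_windowN.
  - by move=> w z /andP[w1 w2]; apply: A4 => //; lra.
  - move=> b; rewrite inE => /orP[/eqP->|bt]; first by lra.
    by apply: (rest (M - b4)) bt; lra.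
  - by rewrite !big_cons -/v; nra.
case: (leP b5 (2 * b4 - M)) => [b54'|b54'].
  rewrite -[[:: b1, b2, b3, b4 & _]]/(s ++ [:: b5, b6 & t]) avg_window_insert.
  apply: le_trans half; apply: avg_le_reflect => z; first exact: avg_windowN.
  by apply: A4.
(* Here [b5] exceeds the reflecting range of the first four weights and joins them; averaging over
   its sign keeps their pair bound. *)
have A5 w z : M - b4 <= w -> w <= 2 * b4 - M ->
    avg (window M) (b5 :: s) (z + w) + avg (window M) (b5 :: s) (z - w) <= 2 * (1 / 2).
  move=> w1 w2; rewrite -cat1s !avg_cat.
  by apply: avg_reflect_stable => y; exact: A4.
case: (leP (M - b4) b6) => [b46|b46].
  rewrite perm5 avg_window_insert.
  apply: le_trans half; apply: avg_le_reflect => z; first exact: avg_windowN.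
  by apply: A5 => //; lra.
rewrite perm5 avg_window_cat.
have -> : 35 / 64 = 1 / 2 + 1 / 8 * (3 / 8) :> R by field.
(* The constant 14 is sharp: [b1 = b2 = b3 = M] and [b4 = b5 = 3 / 4 * M] would leave exactly
   [14 * (M / 4) ^ 2]. *)
apply: (@avg_tail_coarse _ _ _ (M - b4) 14) => //; try lra.
- exact: avg_windowN.
- by move=> w z /andP[w1 w2]; apply: A5 => //; lra.
- by move=> z; rewrite -cat1s avg_cat; exact: avg_le_cst.
- by apply: rest; lra.
- rewrite big_cons -/v.
  have q5 : b5 ^+ 2 <= (3 / 4 * M) ^+ 2 by apply: sq; lra.
  nra.
Qed.

End LargeWeights.
(** * Interval computation *)

Section Checker.
Local Open Scope Z_scope.

Definition cell := (Z * Z)%type.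

Fixpoint remove_at (A : Type) (i : nat) (s : seq A) : seq A :=
  match s, i with
  | [::], _ => [::]
  | _ :: s', 0%N => s'
  | x :: s', S i' => x :: remove_at i' s'
  end.

(* [survivors n p q E / 2 ^ n] bounds the probability that a walk started in
   [p, q], whose [n] steps have sizes in the cells [E] and an order of our
   choice, stays in [(-32, 32)]. A step that surely crosses is played first. *)
Fixpoint survivors (n : nat) (p q : Z) (E : seq cell) : Z :=
  if 32 <=? p then 0 else if q <=? -32 then 0 else
  if n is n'.+1 then
    let: (p', q') := if p + q <? 0 then (- q, - p) else (p, q) in
    let i := (find (fun c : cell => p' + c.1 <? 32) E).-1 in
    let: (l, u) := nth (0, 0) E i in
    let E' := remove_at i E in
    survivors n' (p' + l) (q' + u) E' + survivors n' (p' - u) (q' - l) E'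
  else 1.

(* Numerators of Taylor polynomials of the cosine at [1569 * y / den], over the
   denominators [720 * Q ^ 3] and [40320 * Q ^ 4] where [Q = den ^ 2]. *)
Definition cos_lower (Q y : Z) : Z :=
  let X := 1569 * 1569 * (y * y) in
  720 * (Q * Q * Q) - 360 * (Q * Q * X) + 30 * (Q * X * X) - X * X * X.

Definition cos_upper (Q y : Z) : Z :=
  let X := 1569 * 1569 * (y * y) in
  40320 * (Q * Q * Q * Q) - 20160 * (Q * Q * Q * X) + 1680 * (Q * Q * X * X)
  - 56 * (Q * X * X * X) + X * X * X * X.

(** [1569 / tail_den t] is the largest frequency that [avg_tail] allows for [delta = 32] and
    [m = t]. *)
Definition tail_den (t : Z) : Z := 1000 * (32 + t).

Definition tail_caps : seq Z := [:: 4; 8; 12; 16].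

(* Bounds for [10 ^ 6 * cos (1569 * y / tail_den t)], [y = 0, ..., 32]. *)
Definition cos_lower_table (t : Z) : seq Z :=
  if t =? 4 then
    [:: 1000000; 999050; 996203; 991464; 984842; 976349; 966003; 953821; 939829;
      924051; 906518; 887264; 866324; 843739; 819552; 793807; 766556;
      737847; 707738; 676283; 643543; 609580; 574457; 538242; 501001;
      462806; 423727; 383837; 343212; 301926; 260056; 217679; 174872]
  else
  if t =? 8 then
    [:: 1000000; 999230; 996924; 993084; 987716; 980829; 972432; 962540; 951167;
      938331; 924051; 908349; 891250; 872781; 852968; 831843; 809438;
      785788; 760929; 734899; 707738; 679487; 650191; 619893; 588641;
      556482; 523465; 489640; 455058; 419773; 383837; 347306; 310233]
  else
  if t =? 12 then
    [:: 1000000; 999364; 997457; 994283; 989844; 984147; 977198; 969007; 959584;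
      948941; 937092; 924051; 909835; 894462; 877952; 860326; 841606;
      821815; 800980; 779126; 756282; 732476; 707738; 682099; 655593;
      628253; 600113; 571209; 541577; 511255; 480281; 448694; 416532]
  else
    [:: 1000000; 999465; 997863; 995195; 991464; 986673; 980829; 973936; 966003;
      957038; 947050; 936050; 924051; 911064; 897104; 882185; 866324;
      849537; 831843; 813260; 793807; 773507; 752380; 730449; 707738;
      684269; 660070; 635164; 609580; 583343; 556482; 529025; 501001].

Definition cos_upper_table (t : Z) : seq Z :=
  if t =? 4 then
    [:: 1000000; 999051; 996204; 991465; 984843; 976350; 966004; 953822; 939830;
      924052; 906519; 887265; 866325; 843740; 819553; 793809; 766558;
      737851; 707742; 676289; 643552; 609593; 574476; 538268; 501038;
      462856; 423795; 383930; 343335; 302089; 260269; 217956; 175228]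
  else
  if t =? 8 then
    [:: 1000000; 999231; 996925; 993085; 987717; 980830; 972433; 962541; 951168;
      938332; 924052; 908350; 891252; 872782; 852969; 831844; 809440;
      785790; 760931; 734902; 707742; 679494; 650200; 619905; 588658;
      556504; 523495; 489680; 455112; 419844; 383930; 347425; 310387]
  else
  if t =? 12 then
    [:: 1000000; 999365; 997458; 994284; 989845; 984148; 977199; 969008; 959585;
      948942; 937093; 924052; 909836; 894463; 877953; 860327; 841607;
      821817; 800982; 779129; 756285; 732479; 707742; 682105; 655601;
      628264; 600128; 571228; 541603; 511289; 480325; 448750; 416605]
  else
    [:: 1000000; 999466; 997864; 995196; 991465; 986674; 980830; 973937; 966004;
      957039; 947051; 936051; 924052; 911065; 897105; 882186; 866325;
      849538; 831844; 813261; 793809; 773509; 752383; 730453; 707742;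
      684275; 660078; 635175; 609593; 583360; 556504; 529053; 501038].

Definition cos_tables_ok : bool :=
  all (fun t => let Q := tail_den t * tail_den t in
    all (fun j =>
      let c := nth 0 (cos_lower_table t) j in
      let C := nth 0 (cos_upper_table t) j in
      [&& 0 <=? c, 0 <? C,
          c * (720 * (Q * Q * Q)) <=? 1000000 * cos_lower Q (Z.of_nat j)
        & 1000000 * cos_upper Q (Z.of_nat j) <=? C * (40320 * (Q * Q * Q * Q))])
    (iota 0 33)) tail_caps.

Lemma cos_tables_okT : cos_tables_ok = true.
Proof. by vm_cast_no_check (erefl true). Qed.

(* [(N, n! * D ^ n, a ^ n)] where [N / (n! * D ^ n)] is the Taylor polynomial
   of degree [n] of the exponential at [a / D]. *)
Fixpoint exp_taylor (a D : Z) (n : nat) : Z * Z * Z :=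
  if n is n'.+1 then
    let: (N, F, P) := exp_taylor a D n' in
    let d := Z.of_nat n * D in
    (N * d + P * a, F * d, P * a)
  else (1, 1, 1).

Definition sum_upper_sqr (E : seq cell) : Z := foldr (fun c v => c.2 * c.2 + v) 0 E.

Definition sum_lower_sqr (E : seq cell) : Z :=
  foldr (fun c v => (if 0 <=? c.1 then c.1 * c.1 else 0) + v) 0 E.

(* The thresholds 24 and 16 come from [avg_window_fourth_le] and
   [avg_window_six_le], which settle larger weights. *)
Definition prune (C : seq cell) (t : Z) : bool :=
  [|| 5120 <? sum_lower_sqr C,
      (t <=? 0) && (sum_upper_sqr C <? 5120),
      24 <=? (nth (0, 0) C 3).1,
      16 <=? (nth (0, 0) C 5).1
    | ~~ sorted (fun c c' : cell => c'.1 <? c.2) C].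

Fixpoint dyadic_test (test : nat -> nat -> bool) (d p : nat) : bool :=
  if test p (p + 2 ^ d)%N then true else
  if d is d'.+1 then
    if dyadic_test test d' p then dyadic_test test d' (p + 2 ^ d')%N else false
  else false.

(* [10 ^ 9] times [3 * 2 ^ n / (32 * U)] times a lower bound for
   [exp (1569 ^ 2 * v / (2 * tail_den t ^ 2))]. *)
Definition tail_scale (n : nat) (v t U : Z) : Z :=
  let Q := tail_den t * tail_den t in
  let: (N, F, _) := exp_taylor (1569 * 1569 * v * 1024 / (2 * Q)) 1024 8 in
  3 * 2 ^ Z.of_nat n * N * 1000000000 / (32 * (F * U)).

(** With [lam = 1569 / tail_den t] and [n = size E], up to safe rounding, this asks for [survivors /
    2 ^ n <= 3 / 32 * exp (lam ^ 2 * v / 2) * cos (lam * q) / cos (lam * l1)] on pieces [[p, q]]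
    covering [[0, 32]]. The lower end [l1] is the worst start because [cos x * exp (x ^ 2 / 2)] is
    nonincreasing. *)
Definition tail_test (C : seq cell) (t : Z) : bool :=
  if C is (l1, _) :: E then
    let v := 5120 - l1 * l1 - sum_upper_sqr E in
    if [&& has (Z.eqb t) tail_caps, 0 <=? v, 0 <=? l1 & l1 <=? 32] then
      let kappa := tail_scale (size E) v t (nth 0 (cos_upper_table t) (Z.to_nat l1)) in
      let c := cos_lower_table t in
      all (dyadic_test (fun p q =>
             survivors (size E) (Z.of_nat p) (Z.of_nat q) E * 1000000000
             <=? kappa * nth 0 c q) 3)
          [:: 0; 8; 16; 24]%N
    else false
  else false.

(* Weights up to 16 need no finer cells than the grid of step 4 gives. *)
Definition width (c : cell) : Z := if 16 <? c.2 then c.2 - c.1 else 0.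

Definition widest (C : seq cell) : nat :=
  find (fun c => all (fun c' => width c' <=? width c) C) C.

(* [covered n C t] settles all weight sequences whose first [size C] terms lie in
   the cells [C] and whose other terms are at most [t], using fuel [n]: a cell
   for the next weight is added, or the widest cell is cut in half. *)
Fixpoint covered (n : nat) (C : seq cell) (t : Z) : bool :=
  if n is n'.+1 then
    if prune C t then true else if tail_test C t then true else
    if [&& (size C < 6)%N, 0 <? t & (size C < 3)%N || (4 <? t)] then
      let t' := (t - 1) / 4 * 4 in
      if covered n' C t' then covered n' (rcons C (t', t)) t else false
    else
      let i := widest C in
      let: (l, u) := nth (0, 0) C i in
      let m := (l + u) / 2 in
      if ~~ (i < size C)%N then false else
      if covered n' (set_nth (0, 0) C i (l, m)) t
      then covered n' (set_nth (0, 0) C i (m, u)) t else false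
  else false.

(** The root of the search: no cell is chosen and all weights are at most 32. *)
Lemma covered_all : covered 40 [::] 32 = true.
Proof. by vm_cast_no_check (erefl true). Qed.

End Checker.

(** * Integers as real numbers *)

Section IntegerEmbedding.
Context {R : realType}.

Definition zr (z : Z) : R := (int_of_Z z)%:~R.
Arguments zr z%_Z_scope.

Lemma zrD x y : zr (x + y) = zr x + zr y.
Proof. by rewrite /zr -intrD -rmorphD. Qed.

Lemma zrN x : zr (- x) = - zr x.
Proof. by rewrite /zr -mulrNz -rmorphN. Qed.

Lemma zrB x y : zr (x - y) = zr x - zr y.
Proof. by rewrite -zrN -zrD. Qed.

Lemma zrM x y : zr (x * y) = zr x * zr y.
Proof. by rewrite /zr -intrM -rmorphM. Qed.

Lemma zr_nat n : zr (Z.of_nat n) = n%:R.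
Proof. by rewrite /zr -[Z.of_nat n]/(Z_of_int (Posz n)) Z_of_intK. Qed.

Lemma zr_le x y : Z.leb x y = (zr x <= zr y).
Proof.
rewrite -subr_ge0 -zrB /zr ler0z.
have -> : Z.leb x y = Z.leb 0 (y - x) by lia.
by case: Z.sub.
Qed.

Lemma zr_lt x y : Z.ltb x y = (zr x < zr y).
Proof. by rewrite ltNge -zr_le; lia. Qed.

Lemma zrX x n : zr (x ^ Z.of_nat n) = zr x ^+ n.
Proof.
elim: n => [|n IH]; first by rewrite expr0.
by rewrite Nat2Z.inj_succ Z.pow_succ_r ?zrM ?IH ?exprS //; lia.
Qed.

End IntegerEmbedding.
Arguments zr {R} z%_Z_scope.

(** * Soundness of the survivor count *)

Section CheckerSoundness.
Context {R : realType}.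
Implicit Types (s e r : seq R) (b x : R) (C E : seq cell) (p q t : Z).

(** Cells are open below and closed above, to match the alternative [b <= m] or [m < b] at a cut. *)
Definition boxed s C := all2 (fun b (c : cell) => (zr c.1 < b) && (b <= zr c.2)) s C.

Lemma boxed_size s C : boxed s C -> size s = size C.
Proof. by elim: s C => [|b s IH] [|c C] //= /andP[_ /IH->]. Qed.

Lemma boxed_nth s C i : boxed s C -> (i < size C)%N ->
  zr (nth (Z0, Z0) C i).1 < nth 0 s i <= zr (nth (Z0, Z0) C i).2.
Proof.
elim: s C i => [|b s IH] [|c C] [|i] //= /andP[bc /IH sC] iC //.
exact: sC.
Qed.

Lemma boxed_remove s C i : boxed s C -> boxed (remove_at i s) (remove_at i C).
Proof.
by elim: s C i => [|b s IH] [|c C] [|i] //= /andP[bc /IH sC] //; rewrite bc sC.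
Qed.

Lemma size_remove_at (T : Type) (s : seq T) i :
  (i < size s)%N -> size (remove_at i s) = (size s).-1.
Proof. by elim: s i => [|b [|c s] IH] [|i] //= iC; rewrite IH. Qed.

Lemma perm_remove_at s i : (i < size s)%N ->
  perm_eq s (nth 0 s i :: remove_at i s).
Proof.
elim: s i => [|b s IH] [|i] //= is_.
have := IH _ is_; rewrite -(perm_cons b) => /perm_trans; apply.
exact: (permEl (perm_catCA [:: b] [:: nth 0 s i] _)).
Qed.

Lemma zrN32 : zr (-32) = - zr 32 :> R. Proof. by []. Qed.

Lemma zr32 : zr 32 = 32 :> R. Proof. by []. Qed.

Lemma avg_window_half_le M e x : M <= `|x| -> avg (window M) e x <= 1 / 2.
Proof.
have -> : avg (window M) e x = avg (window M) e `|x|.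
  by case: (ger0P x) => // _; rewrite avg_windowN.
move=> Mx; apply: avg_le_reflect => [|z]; first exact: windowN.
by have := window_reflect z Mx; lra.
Qed.

(** A walk that stays inside throughout with probability [rho] ends inside with probability at most
    [rho + (1 - rho) / 2], since after an exit reflection applies. *)
Lemma survivors_sound n E e p q x : size E = n -> boxed e E ->
  zr p <= x <= zr q ->
  avg (window 32) e x <= 1 / 2 + 1 / 2 * (zr (survivors n p q E) / 2 ^+ n).
Proof.
have out e' m y : zr 32 <= `|y| -> avg (window 32) e' y <= 1 / 2 + 1 / 2 * (zr 0 / 2 ^+ m).
  by rewrite zr32 -[zr 0]/(0 : R) mul0r mulr0 addr0; exact: avg_window_half_le.
elim: n p q x E e => [|n IH] p q x E e En eE pxq /=.
  case: ifP => [|_]; first by rewrite (zr_le (R := R)) => ?; apply: out; rewrite ler_normr; lra.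
  case: ifP => [|_];
    first by rewrite (zr_le (R := R)) zrN32 => ?; apply: out; rewrite ler_normr; lra.
  move: En eE => /size0nil-> /boxed_size/size0nil-> /=.
  by rewrite -[zr 1]/(1 : R) expr0; have := window_le1 32 x; lra.
case: ifP => [|_]; first by rewrite (zr_le (R := R)) => ?; apply: out; rewrite ler_normr; lra.
case: ifP => [|_];
    first by rewrite (zr_le (R := R)) zrN32 => ?; apply: out; rewrite ler_normr; lra.
case pq': (if _ then _ else _) => [p' q'].
have [y [yx /andP[py yq]]] : exists y, avg (window 32) e x = avg (window 32) e y /\
    zr p' <= y <= zr q'.
  case: ifP pq' => _ [<- <-]; last by exists x.
  by exists (- x); rewrite avg_windowN !zrN; split=> //; lra.
(* [find] stops at the first step that need not cross; its predecessor ends the initial run of sure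
   crossings, or is the first cell if there is none. It is in range because [E] is nonempty. *)
set i := (find _ E).-1.
have iE : (i < size E)%N.
  rewrite /i; case: (find _ _) (find_size (fun c : cell => Z.ltb (p' + c.1) 32) E) => //=.
  by rewrite En.
have ie : (i < size e)%N by rewrite (boxed_size eE).
have := boxed_nth eE iE; case: (nth _ E i) => l u /= /andP[lb bu].
rewrite yx (avg_perm _ _ (perm_remove_at ie)) /=.
have En' : size (remove_at i E) = n by rewrite size_remove_at // En.
have eE' := boxed_remove i eE.
have h1 := IH (Z.add p' l) (Z.add q' u) (y + nth 0 e i) _ _ En' eE'.
have h2 := IH (Z.sub p' u) (Z.sub q' l) (y - nth 0 e i) _ _ En' eE'.
rewrite !zrD in h1; rewrite !zrB in h2.
move: (h1 ltac:(lra)) (h2 ltac:(lra)); rewrite zrD exprS.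
rewrite invfM !mulrDl; set k := (2 ^+ n)^-1; lra.
Qed.

End CheckerSoundness.

(** * Soundness of the tail test *)

Section TailTestSoundness.
Context {R : realType}.
Implicit Types (s e r : seq R) (b x z : R) (C E : seq cell) (p q t : Z).

Lemma exp_taylor_le (x : R) n : 0 <= x ->
  \sum_(0 <= i < n) x ^+ i / i`!%:R <= expR x.
Proof.
move=> x0.
have := @nondecreasing_cvgn_le R (series (exp_coeff x)) _ (is_cvg_series_exp_coeff x) n.
rewrite /series /exp_coeff /=; apply.
apply/nondecreasing_seqP => k; rewrite [leRHS]big_nat_recr //= lerDl.
by rewrite divr_ge0 // exprn_ge0.
Qed.

Lemma exp_taylor_ge1 (x : R) n : 0 <= x ->
  1 <= \sum_(0 <= i < n.+1) x ^+ i / i`!%:R.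
Proof.
move=> x0; rewrite big_nat_recl // expr0 fact0 divr1 lerDl sumr_ge0 // => i _.
by rewrite divr_ge0 // exprn_ge0.
Qed.

Lemma exp_taylor_sound a D n N F P : exp_taylor a D n = (N, F, P) ->
  0 < zr D :> R ->
  [/\ zr P = zr a ^+ n :> R, zr F = n`!%:R * zr D ^+ n :> R &
      zr N / zr F = \sum_(0 <= i < n.+1) (zr a / zr D) ^+ i / i`!%:R :> R].
Proof.
elim: n N F P => [|n IH] N F P.
  case=> <- <- <- D0; rewrite -[zr 1]/(1 : R) big_nat1 !expr0 fact0 mulr1.
  by split.
have -> : exp_taylor a D n.+1 =
    let: (N, F, P) := exp_taylor a D n in let d := Z.mul (Z.of_nat n.+1) D in
    (Z.add (Z.mul N d) (Z.mul P a), Z.mul F d, Z.mul P a) by [].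
have := @zr_nat R n.+1; move: (Z.of_nat n.+1) => d dE.
case: exp_taylor IH => [[N' F'] P'] /(_ _ _ _ erefl) IH.
case=> <- <- <- D0.
have [eP eF eN] := IH D0.
have F0 : zr F' != 0 :> R.
  by rewrite eF mulf_neq0 // ?pnatr_eq0 -?lt0n ?fact_gt0 // expf_neq0 // gt_eqF.
have D0' : zr D != 0 :> R by rewrite gt_eqF.
have n0 : n.+1%:R != 0 :> R by rewrite pnatr_eq0.
split.
- by rewrite zrM eP exprSr.
- by rewrite !zrM eF dE factS natrM exprSr; ring.
- rewrite big_nat_recr //= -eN !zrD !zrM dE eP expr_div_n.
  have -> : n.+1`!%:R = zr F' / zr D ^+ n * n.+1%:R :> R.
    by rewrite eF mulfK ?expf_neq0 // factS natrM mulrC.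
  rewrite (exprS _ n) (exprS _ n); move: F0 D0' n0 (expf_neq0 n D0').
  move: (zr D ^+ n) (zr a ^+ n) (n.+1%:R) => y c k F0 D0' n0 d0.
  by field; rewrite F0 D0' n0 d0.
Qed.

Definition tail_freq t : R := zr 1569 / zr (tail_den t).

Lemma tail_caps_ge t : has (Z.eqb t) tail_caps -> t \in tail_caps /\ Z.leb 4 t.
Proof.
case/hasP => u; rewrite !inE => /or4P[]/eqP-> /Z.eqb_eq->; split => //.
Qed.

Lemma cos_tables_bounds t j : has (Z.eqb t) tail_caps -> (j <= 32)%N ->
  let c := zr (nth Z0 (cos_lower_table t) j) in
  let U := zr (nth Z0 (cos_upper_table t) j) in
  [/\ 0 <= c, 0 < U, c <= zr 1000000 * cos (tail_freq t * j%:R) &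
      zr 1000000 * cos (tail_freq t * j%:R) <= U].
Proof.
move=> tc j32; have [t_in t4] := tail_caps_ge tc.
have := cos_tables_okT; rewrite /cos_tables_ok => /allP/(_ t t_in)/allP/(_ j).
rewrite mem_iota add0n ltnS => /(_ j32); move: (nth _ _ _) (nth _ _ _) => U c.
case/and4P; rewrite (zr_le (R := R)) (zr_lt (R := R)) => c0 U0 cl cu.
have den0 : 0 < zr (tail_den t) :> R.
  by rewrite -[0]/(zr 0 : R) -zr_lt /tail_den; lia.
have := den0; rewrite /tail_freq; move: (tail_den t) cl cu {den0} => den cl cu den0.
set x := zr 1569 / zr den * j%:R.
have x0 : 0 <= x.
  by rewrite mulr_ge0 // divr_ge0 ?(ltW den0) // -[0]/(zr 0 : R) -zr_le.
have [] := andP (cos_taylor_bounds x0).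
set Q := Z.mul den den in cl cu.
have S0 : 0 < zr 1000000 :> R by rewrite -[0]/(zr 0 : R) -zr_lt.
have Q0 : 0 < zr Q :> R by rewrite zrM mulr_gt0.
have den0' : zr den != 0 :> R by rewrite gt_eqF.
have Q0' : zr Q != 0 :> R by rewrite gt_eqF.
have z720 : zr 720 = 2 * 12 * 30 :> R.
  by rewrite (_ : zr 720 = zr (2 * 12 * 30)) ?zrM.
have z360 : zr 360 = 12 * 30 :> R.
  by rewrite (_ : zr 360 = zr (12 * 30)) ?zrM.
have z40320 : zr 40320 = 2 * 12 * 30 * 56 :> R.
  by rewrite (_ : zr 40320 = zr (2 * 12 * 30 * 56)) ?zrM.
have z20160 : zr 20160 = 12 * 30 * 56 :> R.
  by rewrite (_ : zr 20160 = zr (12 * 30 * 56)) ?zrM.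
have z1680 : zr 1680 = 30 * 56 :> R.
  by rewrite (_ : zr 1680 = zr (30 * 56)) ?zrM.
have z30 : zr 30 = 30 :> R by [].
have z56 : zr 56 = 56 :> R by [].
move: cl cu; rewrite /cos_lower /cos_upper !(zr_le (R := R)); cbv zeta.
set X := Z.mul (Z.mul 1569 1569) (Z.mul (Z.of_nat j) (Z.of_nat j)).
(* Thus division by [Q ^ 3] or [Q ^ 4] turns the integer tests into Taylor polynomials in
   [x ^ 2]. *)
have XE : zr X = x ^+ 2 * zr Q.
  by rewrite /x !zrM zr_nat; field.
clearbody Q X.
rewrite !(@zrM R, @zrB R, @zrD R) z720 z360 z40320 z20160 z1680 z30 z56 XE.
have -> : x ^+ 4 = (x ^+ 2) ^+ 2 by rewrite -exprM.
have -> : x ^+ 6 = (x ^+ 2) ^+ 3 by rewrite -exprM.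
have -> : x ^+ 8 = (x ^+ 2) ^+ 4 by rewrite -exprM.
move: (_ ^+ 2) => y cl cu lo hi; split=> //.
- apply: le_trans (ler_wpM2l (ltW S0) lo).
  rewrite -(ler_pM2r (_ : 0 < 2 * 12 * 30 * zr Q ^+ 3)); last by rewrite mulr_gt0 ?exprn_gt0.
  by rewrite /is_true -[RHS]cl; congr (_ <= _); [ring | field].
- apply: le_trans (ler_wpM2l (ltW S0) hi) _.
  rewrite -(ler_pM2r (_ : 0 < 2 * 12 * 30 * 56 * zr Q ^+ 4)); last by rewrite mulr_gt0 ?exprn_gt0.
  by rewrite /is_true -[RHS]cu; congr (_ <= _); [field | ring].
Qed.

Lemma dyadic_test_sound test d (p : nat) x : dyadic_test test d p ->
  p%:R <= x <= (p + 2 ^ d)%:R ->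
  exists p' q' : nat, [/\ test p' q', p'%:R <= x <= q'%:R & (q' <= p + 2 ^ d)%N].
Proof.
elim: d p => [|d IH] p /=.
  by case: ifP => // tp _ px; exists p, (p + 2 ^ 0)%N.
case: ifP => [tp _ px|_]; first by exists p, (p + 2 ^ d.+1)%N.
case: ifP => // pl pr /andP[px xq].
case: (leP x (p + 2 ^ d)%:R) => xm.
  have [|p' [q' [pq xpq q'p]]] := IH p pl; first by rewrite px.
  exists p', q'; split=> //; apply: leq_trans q'p _.
  by rewrite leq_add2l leq_exp2l.
have [|p' [q' [pq xpq q'p]]] := IH _ pr.
  by rewrite (ltW xm) -addnA addnn -mul2n -expnS.
by exists p', q'; split=> //; rewrite expnS mul2n -addnn addnA.
Qed.

Lemma dyadic_starts z : 0 <= z < 32 -> exists p : nat,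
  [/\ p \in [:: 0; 8; 16; 24]%N, (p + 2 ^ 3 <= 32)%N & p%:R <= z <= (p + 2 ^ 3)%:R].
Proof.
move=> z32; have half m : m%:R <= z <= m%:R + 8 -> m%:R <= z <= (m + 2 ^ 3)%:R.
  by rewrite natrD.
case: (leP z 16) => z16.
  by case: (leP z 8) => z8; [exists 0%N | exists 8%N]; split=> //; apply: half; lra.
by case: (leP z 24) => z24; [exists 16%N | exists 24%N]; split=> //; apply: half; lra.
Qed.

Lemma sum_upper_sqr_ge s C : boxed s C -> (forall b, b \in s -> 0 <= b) ->
  \sum_(b <- s) b ^+ 2 <= zr (sum_upper_sqr C).
Proof.
elim: s C => [|b s IH] [|[l u] C] //= => [_ _|/andP[/andP[lb bu] sC] s0].
  by rewrite big_nil -[0]/(zr 0 : R).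
have b0 : 0 <= b by apply: s0; rewrite mem_head.
rewrite big_cons zrD zrM -expr2; apply: lerD.
  by rewrite ler_sqr ?nnegrE // (le_trans b0).
by apply: IH => // c cs; apply: s0; rewrite inE cs orbT.
Qed.

Lemma tail_freqP t : has (Z.eqb t) tail_caps ->
  [/\ 0 <= zr t :> R, 0 < zr (tail_den t) :> R, 0 <= tail_freq t,
      tail_freq t * zr (tail_den t) = 1569 &
      1000 * (tail_freq t * (32 + zr t)) = 1569].
Proof.
move=> tc; have [_ t4] := tail_caps_ge tc.
have t0 : 0 <= zr t :> R by rewrite -[0]/(zr 0 : R) -zr_le; lia.
have den0 : 0 < zr (tail_den t) :> R.
  by rewrite -[0]/(zr 0 : R) -zr_lt /tail_den; lia.
have denE : zr (tail_den t) = 1000 * (32 + zr t) :> R by rewrite /tail_den zrM zrD.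
have lamE : tail_freq t * zr (tail_den t) = 1569 by rewrite /tail_freq divfK ?gt_eqF.
split=> //; first by rewrite divr_ge0 ?(ltW den0) // -[0]/(zr 0 : R) -zr_le.
by rewrite -lamE denE; ring.
Qed.

(** Every rounding errs downwards: both integer divisions are floors, and the Taylor value [k] lies
    below the exponential. *)
Lemma tail_scale_bound n v t U : Z.leb 0 v -> has (Z.eqb t) tail_caps ->
  Z.ltb 0 U -> exists2 k : R, 0 < k <= expR (tail_freq t ^+ 2 / 2 * zr v) &
    zr (tail_scale n v t U) * (32 * zr U) <= 3 * 2 ^+ n * k * zr 1000000000.
Proof.
move=> v0 tc U0.
have [_ t4] := tail_caps_ge tc.
have [t0 den0 lam0 lamE _] := tail_freqP tc; set lam := tail_freq t in lam0 lamE *.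
cbv delta [tail_scale]; cbv beta zeta.
set Q := Z.mul (tail_den t) (tail_den t).
have QE : zr Q = zr (tail_den t) ^+ 2 :> R by rewrite /Q zrM.
have Q0 : Z.lt 0 Q by rewrite /Q /tail_den; lia.
clearbody Q.
set a := Z.div _ (Z.mul 2 Q).
have a0 : 0 <= zr a :> R.
  by rewrite -[0]/(zr 0 : R) -zr_le; apply/Z.leb_le/Z.div_pos; lia.
have aQ : zr a * (2 * zr Q) <= 1569 * 1569 * zr v * zr 1024 :> R.
  rewrite -[2]/(zr 2 : R) -[1569]/(zr 1569 : R) -!zrM -zr_le; apply/Z.leb_le.
  by rewrite Z.mul_comm; apply: Z.mul_div_le; lia.
clearbody a.
have D0 : 0 < zr 1024 :> R by rewrite -[0]/(zr 0 : R) -zr_lt.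
have aE : zr a / zr 1024 <= lam ^+ 2 / 2 * zr v.
  rewrite ler_pdivrMr //.
  have -> : lam ^+ 2 / 2 * zr v * zr 1024 =
      1569 * 1569 * zr v * zr 1024 / (2 * zr Q) :> R.
    rewrite QE -lamE; move: (zr (tail_den t)) den0 => D D0'; field.
    by rewrite gt_eqF.
  rewrite ler_pdivlMr // mulr_gt0 // -[0]/(zr 0 : R) -zr_lt; exact/Z.ltb_lt.
case ET: (exp_taylor a 1024 8) => [[N F] P].
have [_ FE NE] := exp_taylor_sound ET D0.
have y0 : 0 <= zr a / zr 1024 :> R by rewrite divr_ge0 // ltW.
have F0 : 0 < zr F :> R.
  by rewrite FE mulr_gt0 ?exprn_gt0 // ltr0n fact_gt0.
clear ET FE; move: (zr a / zr 1024) y0 aE NE => y y0 aE NE.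
have NF0 : 0 < zr N / zr F :> R.
  by rewrite NE; apply: lt_le_trans ltr01 (exp_taylor_ge1 _ y0).
have Nexp : zr N / zr F <= expR y by rewrite NE; exact: exp_taylor_le.
set kappa := Z.div _ _.
have FU0 : Z.lt 0 (Z.mul F U).
  by apply: Z.mul_pos_pos; apply/Z.ltb_lt => //; rewrite (zr_lt (R := R)).
have kE : zr kappa * (32 * (zr F * zr U)) <= 3 * 2 ^+ n * zr N * zr 1000000000 :> R.
  rewrite -[32]/(zr 32 : R) -[3]/(zr 3 : R) -[2]/(zr 2 : R) -zrX -!zrM -zr_le; apply/Z.leb_le.
  by rewrite Z.mul_comm; apply: Z.mul_div_le; exact: Z.mul_pos_pos.
exists (zr N / zr F); first by rewrite NF0 (le_trans Nexp) // ler_expR.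
have -> : 3 * 2 ^+ n * (zr N / zr F) * zr 1000000000 =
    3 * 2 ^+ n * zr N * zr 1000000000 / zr F :> R.
  by rewrite !mulrA [in RHS]mulrAC.
rewrite ler_pdivlMr //.
have -> // : zr kappa * (32 * zr U) * zr F =
    zr kappa * (32 * (zr F * zr U)) :> R.
by move: (zr kappa) (zr U) (zr F) => *; ring.
Qed.

(** Start at [b1], play the small weights [r] first and [e] last: [avg_tail] applies to
    [avg (window 32) e] with [A = 1 / 2], [delta = 32] and [m = zr t]. *)
Lemma tail_test_sound l u E b1 e r t :
  tail_test ((l, u) :: E) t -> boxed (b1 :: e) ((l, u) :: E) ->
  (forall b, b \in r -> 0 <= b <= zr t) -> (forall b, b \in e -> 0 <= b) ->
  0 <= b1 < 32 -> \sum_(b <- b1 :: e ++ r) b ^+ 2 = zr 5120 ->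
  avg (window 32) (b1 :: e ++ r) 0 <= 35 / 64.
Proof.
rewrite /tail_test.
set v := Z.sub _ (sum_upper_sqr E).
case: ifP => // /and4P[tc v0 l0 l32].
have l32' : (Z.to_nat l <= 32)%N by lia.
have zl : (Z.to_nat l)%:R = zr l :> R by rewrite -zr_nat Z2Nat.id //; lia.
have vE : zr v = zr 5120 - zr l * zr l - zr (sum_upper_sqr E) :> R by rewrite !zrB zrM.
clearbody v.
have [t0 den0 lam0 lamE t32] := tail_freqP tc; set lam := tail_freq t in lam0 lamE t32 *.
clear lamE den0; move: (zr 5120) vE => total vE.
(* [S] is [10 ^ 6]; scales and table entries become variables, so that no tactic computes with large
   numerals. *)
have [S [S0 table]] : exists S : R, 0 < S /\ forall j, (j <= 32)%N ->
    let c := zr (nth Z0 (cos_lower_table t) j) in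
    let U := zr (nth Z0 (cos_upper_table t) j) in
    [/\ 0 <= c, 0 < U, c <= S * cos (lam * j%:R) & S * cos (lam * j%:R) <= U].
  exists (zr 1000000); split; first by rewrite -[0]/(zr 0 : R) -zr_lt.
  by move=> j; exact: cos_tables_bounds.
have [_ U0 _ cU] := table _ l32'.
rewrite zl in cU.
cbv zeta; set U := nth _ (cos_upper_table t) _ in U0 cU *.
have zU0 : Z.ltb 0 U by rewrite (zr_lt (R := R)).
have [k [kappa [G [k0 ke G0 kE test_le]]]] : exists k kappa G : R,
    [/\ 0 < k, k <= expR (lam ^+ 2 / 2 * zr v), 0 < G,
        kappa * (32 * zr U) <= 3 * 2 ^+ size E * k * G &
        forall w c, Z.leb (Z.mul w 1000000000) (Z.mul (tail_scale (size E) v t U) c) ->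
                    zr w * G <= kappa * zr c].
  have [k /andP[k0 ke] kE] := tail_scale_bound (size E) v0 tc zU0.
  exists k, (zr (tail_scale (size E) v t U)), (zr 1000000000).
  split; [exact: k0 | exact: ke | by rewrite -[0]/(zr 0 : R) -zr_lt | exact: kE |].
  by move=> w c; rewrite (zr_le (R := R)) !zrM.
move: (tail_scale _ _ _ _) test_le => kappa' test_le; clearbody U lam.
move=> /allP tests /andP[/andP[lb1 b1u] eE] rt e0 /andP[b10 b132] sumb.
(* The damped cosine at [b1] will be bounded by [zr U / S / k], so this [K] leaves exactly
   [3 / 64]. *)
pose K : R := 3 / 64 * k * (S / zr U).
have K0 : 0 <= K.
  apply: mulr_ge0; last by apply: divr_ge0; exact: ltW.
  by apply: mulr_ge0; [exact: divr_ge0 (ler0n _ _) (ler0n _ _) | exact: ltW].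
have lam32 : lam * 32 <= 1569 / 1000.
  have : lam * 32 <= lam * (32 + zr t) by rewrite ler_wpM2l // lerDl.
  by move: t32; lra.
have lam_le x : x <= 32 -> lam * x <= 2.
  by move=> x32; have : lam * x <= lam * 32 by [rewrite ler_wpM2l]; move: lam32; clear; lra.
have cells (z : R) : `|z| < 32 -> exists p q : nat,
    [/\ zr (survivors (size E) (Z.of_nat p) (Z.of_nat q) E) * G
          <= kappa * zr (nth Z0 (cos_lower_table t) q) :> R,
        p%:R <= `|z| <= q%:R & (q <= 32)%N].
  move=> z32.
  have [|p [p_in p32 pz]] := dyadic_starts (z := `|z|); first by rewrite normr_ge0.
  have [p' [q' [test pzq q'p]]] := dyadic_test_sound (tests p p_in) pz.
  exists p', q'; split=> //; last exact: leq_trans q'p p32.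
  exact: test_le.
have inside z : `|z| < 32 -> avg (window 32) e z <= 1 / 2 + K * cos (lam * z).
  move=> z32; have [p [q [test /andP[pz zq] q32]]] := cells z z32.
  have -> : avg (window 32) e z = avg (window 32) e `|z|.
    by case: (ger0P z) => // _; rewrite avg_windowN.
  have -> : cos (lam * z) = cos (lam * `|z|).
    by rewrite -cos_norm normrM (ger0_norm lam0).
  have [c0 _ cq _] := table _ q32.
  (* The cosine decreases on [[0, pi]], so the right end of a piece is its worst point. *)
  have cos_le : cos (lam * q%:R) <= cos (lam * `|z|).
    have q32' : q%:R <= 32 :> R by rewrite ler_nat.
    have pi2 x : x <= 32 -> lam * x <= pi by move=> /lam_le/le_trans; apply; exact: pi_ge2.
    rewrite leNgt ltr_cos ?in_itv /= ?mulr_ge0 ?pi2 // ?(ltW z32) //.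
    by rewrite -leNgt ler_wpM2l.
  have pzq : zr (Z.of_nat p) <= `|z| <= zr (Z.of_nat q) by rewrite !zr_nat pz.
  apply: le_trans (survivors_sound (erefl (size E)) eE pzq) _.
  rewrite lerD2l; apply: (@le_trans _ _ (K * (zr (nth Z0 (cos_lower_table t) q) / S))).
    move: test c0; move: (zr (nth _ _ _)) (zr (survivors _ _ _ _)) => c w test c0.
    have wc : w * (32 * zr U) <= 3 * 2 ^+ size E * k * c.
      have U32 : 0 <= 32 * zr U :> R by rewrite mulr_ge0 // ltW.
      rewrite -(ler_pM2r G0) mulrAC; apply: le_trans (ler_wpM2r U32 test) _.
      rewrite mulrAC; apply: le_trans (ler_wpM2r c0 kE) _.
      by rewrite mulrAC.
    have p0 : 0 < 2 ^+ size E :> R by rewrite exprn_gt0.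
    rewrite /K; move: (zr U) (2 ^+ size E) U0 p0 wc => U1 p2 U0 p0 wc.
    have -> : 1 / 2 * (w / p2) = w * (32 * U1) / (64 * p2 * U1).
      by field; rewrite !gt_eqF.
    have -> : 3 / 64 * k * (S / U1) * (c / S) = 3 * p2 * k * c / (64 * p2 * U1).
      by field; rewrite !gt_eqF.
    by apply: ler_wpM2r wc; rewrite invr_ge0 !mulr_ge0 // ltW.
  apply: ler_wpM2l => //; apply: le_trans cos_le.
  by rewrite ler_pdivrMr // mulrC.
rewrite avg_start; last exact: windowN.
rewrite (avg_perm _ _ (t := r ++ e)); last by rewrite perm_catC.
rewrite avg_cat; have -> : 35 / 64 = 1 / 2 + 3 / 64 :> R by field.
have b1abs : `|b1| < 32 by rewrite ger0_norm.
apply: le_trans (avg_tail (avg_windowN 32 e) _ inside K0 lam0 _ rt b1abs) _.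
- move=> w z /andP[w32 _]; apply: avg_reflect_stable => y.
  by have := window_reflect y w32; clear; lra.
- by rewrite t32.
rewrite lerD2l -mulrA; set V := \sum_(b <- r) b ^+ 2.
have VE : V = total - b1 ^+ 2 - \sum_(b <- e) b ^+ 2.
  by move: sumb; rewrite big_cons big_cat /= -/V; clear; lra.
have eU := sum_upper_sqr_ge eE e0.
have zl0 : 0 <= zr l :> R by rewrite -[0]/(zr 0 : R) -zr_le.
have decay := @cos_mul_expR_nincr R (lam * zr l) (lam * b1)
  (mulr_ge0 lam0 zl0) (ler_wpM2l lam0 (ltW lb1)) (lam_le _ (ltW b132)).
have : cos (lam * b1) * expR (- (lam ^+ 2 / 2) * V) <= zr U / S * k^-1.
  set T := - (lam ^+ 2 / 2) * (V + b1 ^+ 2).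
  (* The split forms the function of [decay]; the sum [V + b1 ^ 2] left in [T] depends on [e]
     alone. *)
  have -> : - (lam ^+ 2 / 2) * V = (lam * b1) ^+ 2 / 2 + T by rewrite /T; field.
  rewrite expRD mulrA; apply: le_trans (ler_wpM2r (expR_ge0 T) decay) _.
  rewrite -[X in X <= _]mulrA -expRD; set W := _ + T.
  have WE : W <= - (lam ^+ 2 / 2 * zr v).
    have : lam ^+ 2 / 2 * zr v <= lam ^+ 2 / 2 * (V + b1 ^+ 2 - zr l ^+ 2).
      by apply: ler_wpM2l; [rewrite divr_ge0 ?sqr_ge0 | rewrite vE VE -expr2; move: eU; clear; lra].
    have -> : W = - (lam ^+ 2 / 2 * (V + b1 ^+ 2 - zr l ^+ 2)) by rewrite /W /T; field.
    clear; lra.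
  apply: (@le_trans _ _ (zr U / S * expR W)).
    by apply: (ler_wpM2r (expR_ge0 _)); rewrite ler_pdivlMr // mulrC.
  apply: ler_wpM2l; first by rewrite divr_ge0 // ltW.
  apply: (@le_trans _ _ (expR (- (lam ^+ 2 / 2 * zr v)))); first by rewrite ler_expR.
  by rewrite expRN lef_pV2 ?posrE ?expR_gt0.
move/(ler_wpM2l K0)/le_trans; apply.
rewrite le_eqVlt; apply/orP; left; apply/eqP; rewrite /K.
move: (zr U) U0 => U1 U0.
by field; rewrite !gt_eqF.
Qed.

End TailTestSoundness.

(** * Soundness of the case distinction *)

Section CoverSoundness.
Context {R : realType}.
Implicit Types (s e r : seq R) (b x : R) (C E : seq cell) (t : Z).

(** What remains once [b1 >= 32], [b4 >= 24] and [b6 >= 16] are settled; indices start at 0, and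
    [5120 = 5 * 32 ^ 2]. *)
Definition admissible s :=
  [/\ sorted >=%R s, forall b, b \in s -> 0 <= b, \sum_(b <- s) b ^+ 2 = zr 5120 &
      [/\ nth 0 s 0 < 32, nth 0 s 3 < 24 & nth 0 s 5 < 16]].

Lemma sum_lower_sqr_le s C : boxed s C -> zr (sum_lower_sqr C) <= \sum_(b <- s) b ^+ 2.
Proof.
elim: s C => [|b s IH] [|[l u] C] //= => [_|/andP[/andP[lb bu] sC]].
  by rewrite big_nil -[0]/(zr 0 : R).
rewrite big_cons zrD lerD ?IH //.
case: ifP => [|_]; last by rewrite -[zr 0]/(0 : R) sqr_ge0.
rewrite (zr_le (R := R)) -[zr 0]/(0 : R) zrM -expr2 => l0.
by rewrite ler_sqr ?nnegrE // ?(le_trans l0) // ltW.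
Qed.

Lemma boxed_sorted s C : boxed s C -> sorted >=%R s ->
  sorted (fun c c' : cell => Z.ltb c'.1 c.2) C.
Proof.
case: s C => [|b s] [|c C] //=.
elim: s b c C => [|b' s IH] b c [|c' C] //=; first by rewrite andbF.
case/andP=> /andP[lb bu] /andP[bc' sC] /andP[b'b bs].
rewrite (IH b') ?bc' // andbT (zr_lt (R := R)).
by case/andP: bc' => l'b' _; rewrite (lt_le_trans l'b') // (le_trans b'b).
Qed.

(** The tests contradict, in turn, the square sum from above and from below, the caps on the fourth
    and sixth weights, and the order. *)
Lemma prune_sound C t s r : prune C t -> boxed s C ->
  (forall b, b \in r -> 0 <= b <= zr t) -> admissible (s ++ r) -> False.
Proof.
move=> pC sC rt [sorted_sr sr0 sum_sr [_ sr3 sr5]].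
have r0 : 0 <= \sum_(b <- r) b ^+ 2 by exact: sumr_sqr_ge0.
have small i z : Z.leb z (nth (Z0, Z0) C i).1 -> Z.ltb 0 z -> nth 0 (s ++ r) i < zr z -> False.
  rewrite (zr_le (R := R)) (zr_lt (R := R)) => zl z0 lz.
  case: (ltnP i (size C)) => iC.
    have /andP[+ _] := boxed_nth sC iC; rewrite nth_cat (boxed_size sC) iC in lz *.
    by move: lz zl; lra.
  (* Past the end of [C] the default cell has lower end 0, below the positive threshold. *)
  by move: zl; rewrite nth_default //= -[zr 0]/(0 : R) in z0 *; lra.
rewrite big_cat /= in sum_sr.
case/or4P: pC => [|/andP[]||/orP[]].
- by rewrite (zr_lt (R := R)); have := sum_lower_sqr_le sC; lra.
- rewrite (zr_le (R := R)) (zr_lt (R := R)) -[zr 0]/(0 : R) => t0 Cu.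
  have rsum : \sum_(b <- r) b ^+ 2 = 0.
    apply: big1_seq => b /andP[_ br]; have bt := rt b br; have -> : b = 0 by lra.
    by rewrite expr0n.
  have sle : \sum_(b <- s) b ^+ 2 <= zr (sum_upper_sqr C).
    by apply: sum_upper_sqr_ge => // b bs; apply: sr0; rewrite mem_cat bs.
  by move: sum_sr; rewrite rsum; lra.
- by move/small; apply.
- by move/small; apply.
- by rewrite (boxed_sorted sC) //; case/cat_sorted2: sorted_sr.
Qed.

Lemma boxed_set s C i c : boxed s C -> (i < size C)%N ->
  (zr c.1 < nth 0 s i) && (nth 0 s i <= zr c.2) -> boxed s (set_nth (Z0, Z0) C i c).
Proof.
elim: s C i => [|b s IH] [|c' C] [|i] //= /andP[bc sC] iC bi; first by rewrite bi.
by rewrite bc IH.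
Qed.

Lemma boxed_rcons s C b c : boxed s C -> (zr c.1 < b) && (b <= zr c.2) ->
  boxed (rcons s b) (rcons C c).
Proof.
elim: s C => [|b' s IH] [|c' C] //= => [_ ->|/andP[-> /IH]] //; exact.
Qed.

Lemma covered_sound n C t s r : covered n C t -> boxed s C ->
  (forall b, b \in r -> 0 <= b <= zr t) -> admissible (s ++ r) ->
  avg (window 32) (s ++ r) 0 <= 35 / 64.
Proof.
elim: n C t s r => [//|n IH] C t s r; rewrite [covered _ _ _]/=.
case: ifP => [pC _ sC rt adm|_]; first by case: (prune_sound pC sC rt adm).
case: ifP => [tC _ sC rt [_ sr0 sum_sr [sr1 _ _]]|_].
  case: C s sC tC sr0 sum_sr sr1 => [//|[l u] E] [//|b1 e] sC tC sr0 sum_sr sr1.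
  apply: tail_test_sound tC sC rt _ _ sum_sr.
    by move=> b be; apply: sr0; rewrite inE mem_cat be orbT.
  by rewrite sr1 sr0 // mem_head.
case: ifP => _.
  case: ifP => // cov1 cov2 sC rt adm.
  have [srs sr0 _ _] := adm.
  case: r rt adm srs sr0 => [|b r] rt adm srs sr0; first exact: IH cov1 sC _ adm.
  have rb c : c \in r -> c <= b.
    have : sorted >=%R (b :: r) by case/cat_sorted2: srs.
    by move=> /= /(order_path_min ge_trans)/allP; apply.
  have br : 0 <= b <= zr t by apply: rt; rewrite mem_head.
  have r0 c : c \in r -> 0 <= c.
    by move=> cr; have /andP[] : 0 <= c <= zr t by apply: rt; rewrite inE cr orbT.
  set t' := Z.mul _ 4 in cov1 cov2.
  (* As [b] is the largest weight left, either [t'] caps all of them or [b] lies in the new cell. *)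
  case: (leP b (zr t')) => bt.
    apply: IH cov1 sC _ adm => c; rewrite inE => /orP[/eqP->|cr]; first by rewrite bt; lra.
    by rewrite r0 // (le_trans (rb c cr)).
  rewrite -cat_rcons; apply: IH cov2 _ _ _.
  - by apply: boxed_rcons; rewrite //= bt; lra.
  - by move=> c cr; apply: rt; rewrite inE cr orbT.
  - by rewrite cat_rcons.
case nthi: (nth _ _ _) => [l u].
case: ifP => // /negbFE iC; case: ifP => // cov1 cov2 sC rt adm.
have := boxed_nth sC iC; rewrite nthi /= => /andP[lb bu].
case: (leP (nth 0 s (widest C)) (zr (Z.div (Z.add l u) 2))) => bm.
  by apply: IH cov1 _ rt adm; apply: boxed_set => //=; rewrite lb.
by apply: IH cov2 _ rt adm; apply: boxed_set => //=; rewrite bm.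
Qed.

End CoverSoundness.
(** * Rademacher sums *)

Section WindowBound.
Context {R : realType}.
Implicit Types (s : seq R) (b x : R).

(** Padding by zeros ensures the six leading weights that the case distinction names. *)
Lemma avg_cat0 (f : R -> R) s n x : avg f (s ++ nseq n (0%R : R)) x = avg f s x.
Proof.
rewrite (avg_perm _ _ (t := nseq n (0%R : R) ++ s)); last by rewrite perm_catC.
by elim: n x => //= n IH x; rewrite addr0 subr0 !IH; field.
Qed.

Lemma avg_window_bound s : sorted >=%R s -> (forall b, b \in s -> 0 <= b) ->
  \sum_(b <- s) b ^+ 2 = 5 * 32 ^+ 2 -> avg (window 32) s 0 <= 35 / 64.
Proof.
move=> s_sorted s0 s_sum; rewrite -(avg_cat0 _ s 6).
have : sorted >=%R (s ++ nseq 6 (0%R : R)).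
  case: s s_sorted s0 {s_sum} => [|b s] /= bs s0; first by rewrite !lexx.
  rewrite cat_path bs /= !lexx !andbT; exact/s0/mem_last.
have : forall b, b \in s ++ nseq 6 (0%R : R) -> 0 <= b.
  by move=> b; rewrite mem_cat mem_nseq => /orP[/s0//|/andP[_ /eqP->]].
have : \sum_(b <- s ++ nseq 6 (0%R : R)) b ^+ 2 = 5 * 32 ^+ 2.
  by rewrite big_cat /= s_sum !big_cons big_nil expr0n /= !addr0.
have : (6 <= size (s ++ nseq 6 (0%R : R)))%N by rewrite size_cat size_nseq leq_addl.
case: (s ++ nseq 6 (0%R : R)) => [|b1 [|b2 [|b3 [|b4 [|b5 [|b6 t]]]]]] // _ {s_sorted s0 s_sum}.
move=> sum_s s0 s_sorted.
have t6 b : b \in t -> b <= b6.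
  by move: s_sorted => /= /and5P[_ _ _ _ /andP[_ /(order_path_min ge_trans)/allP bt]] /bt.
have [b12 b23 b34 b45 b56] : [/\ b2 <= b1, b3 <= b2, b4 <= b3, b5 <= b4 & b6 <= b5].
  by move: s_sorted => /= /and5P[? ? ? ? /andP[]].
have b60 : 0 <= b6 by apply: s0; rewrite !inE eqxx !orbT.
case: (leP 32 b1) => [b1_ge|b1_lt].
  by apply: le_trans (avg_window_large_le _ b1_ge) _; lra.
case: (leP 16 b6) => [b6_ge|b6_lt].
  apply: (@avg_window_six_le R 32 [:: b1; b2; b3; b4; b5; b6] t) => //.
  by move=> b; rewrite !inE => /orP[/eqP->|/orP[/eqP->|/or4P[]/eqP->]]; lra.
case: (leP 24 b4) => [b4_ge|b4_lt].
  apply: avg_window_fourth_le => //; try lra.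
  by move=> b bt; rewrite t6 // s0 // !inE bt !orbT.
have rest b : b \in [:: b1, b2, b3, b4, b5, b6 & t] -> 0 <= b <= zr 32.
  move=> bs; rewrite s0 //= zr32 (le_trans _ (ltW b1_lt)) //.
  move: bs; rewrite inE => /orP[/eqP->//|].
  have : path >=%R b1 [:: b2, b3, b4, b5, b6 & t] := s_sorted.
  by move/(order_path_min ge_trans)/allP; apply.
apply: (covered_sound (s := [::]) covered_all isT rest).
split=> //; rewrite sum_s (_ : zr 5120 = zr (5 * (32 * 32))) // !zrM zr32 -expr2.
by congr (_ * _).
Qed.

End WindowBound.

(** * From averages over signs to probabilities *)

Section SignTuples.
Context {R : realType} {d : measure_display} {T : measurableType d}.
Context (P : probability T R) (n : nat) (eps : 'I_n -> {RV P >-> R}).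
Context (eps_indep : mutually_independent eps) (eps_sign : forall i, random_sign (eps i)).

Definition sign_value (b : bool) : R := if b then 1 else -1.

Definition signs_event (sg : 'I_n -> bool) (k : nat) : set T :=
  \bigcap_(i in [set i : 'I_n | (i < k)%N]) (eps i @^-1` [set sign_value (sg i)]).

Lemma measurable_signs_event sg k : measurable (signs_event sg k).
Proof.
exact: fin_bigcap_measurable.
Qed.

Lemma prob_signs_event sg : P (signs_event sg n) = (2^-1 ^+ n)%:E.
Proof.
have := @eps_indep [set: 'I_n]%SET (fun i => [set sign_value (sg i)])
  (fun i _ => measurable_set1 _).
have -> : \bigcap_(i in [set` [set: 'I_n]%SET]) (eps i @^-1` [set sign_value (sg i)]) =
    signs_event sg n.
  by apply/seteqP; split=> w h i _; apply: h; rewrite /= ?inE.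
move=> ->; rewrite (eq_bigr (fun=> (2^-1)%:E)); last first.
  by move=> i _; have [p1 pN1] := eps_sign i; rewrite /sign_value; case: (sg i).
by rewrite prodEFin prodr_const cardsT card_ord.
Qed.

Lemma prob_signs_sum_ge (c : 'I_n -> R) (M : R) k sg : (k <= n)%N ->
  measurable [set w | (M <= `|\sum_(i < n) c i * eps i w|)%R] ->
  ((2^-1 ^+ k * (1 - avg (window M) (drop k [seq c i | i <- enum 'I_n])
       (\sum_(i < n | (i < k)%N) sign_value (sg i) * c i)))%:E <=
   P (signs_event sg k `&` [set w | (M <= `|\sum_(i < n) c i * eps i w|)%R]))%E.
Proof.
move=> kn good_m; set good := [set w | _] in good_m *.
have sizec : size [seq c i | i <- enum 'I_n] = n by rewrite size_map size_enum_ord.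
move: {2}(n - k)%N (erefl (n - k)%N) => m mE.
elim: m k sg kn mE => [|m IH] k sg kn mE.
  (* All signs are fixed, so the sum is constant on the event and [window] tells whether it is too
     small. *)
  have -> : k = n by apply/eqP; rewrite eqn_leq kn -subn_eq0 mE.
  rewrite drop_oversize ?sizec //= /window.
  case: ltP => [_|Mle]; first by rewrite subrr mulr0 measure_ge0.
  rewrite subr0 mulr1 -(prob_signs_event sg).
  suff -> : signs_event sg n `&` good = signs_event sg n by [].
  apply/setIidl => w; rewrite /signs_event /bigcap /= => ew.
  rewrite /good /=; apply: le_trans Mle _; rewrite le_eqVlt; apply/orP; left; apply/eqP.
  congr (`|_|); apply: eq_big => i; first exact: ltn_ord.
  by move=> _; rewrite (ew i (ltn_ord i)) mulrC.
have {}kn : (k < n)%N by rewrite -subn_gt0 mE.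
pose i0 := Ordinal kn.
pose upd b : 'I_n -> bool := fun i => if i == i0 then b else sg i.
have eventS b : signs_event (upd b) k.+1 =
    signs_event sg k `&` (eps i0 @^-1` [set sign_value b]).
  apply/seteqP; split=> w /=; rewrite /signs_event /bigcap /= => ew.
    split=> [i ik|]; last by have := ew i0 (ltnSn _); rewrite /upd eqxx.
    have := ew i (ltnW ik); rewrite /upd; case: eqP => // ii0.
    by move: ik; rewrite ii0 ltnn.
  case: ew => ew e0 i; rewrite /upd; case: eqP => [->//|/eqP ii0] ik.
  apply: ew; rewrite ltn_neqAle -ltnS ik andbT.
  by apply: contra ii0 => /eqP ik'; apply/eqP/val_inj.
have sumS b : \sum_(i < n | (i < k.+1)%N) sign_value (upd b i) * c i =
    \sum_(i < n | (i < k)%N) sign_value (sg i) * c i + sign_value b * c i0.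
  rewrite (bigD1 i0) //= addrC /upd eqxx; congr (_ + _).
  apply: eq_big => i.
    by rewrite ltnS [in RHS]ltn_neqAle andbC.
  by case/andP=> _ /negPf->.
have dropk : drop k [seq c i | i <- enum 'I_n] =
    c i0 :: drop k.+1 [seq c i | i <- enum 'I_n].
  rewrite (drop_nth 0) ?sizec //; congr (_ :: _).
  by rewrite (nth_map i0) ?size_enum_ord // (_ : k = i0 :> nat) // nth_ord_enum.
have IHb b := IH k.+1 (upd b) kn _.
have mE' : (n - k.+1 = m)%N by rewrite subnS mE.
have disj : (signs_event (upd true) k.+1 `&` good) `&`
    (signs_event (upd false) k.+1 `&` good) = set0.
  rewrite !eventS; apply/seteqP; split=> // w [[[_ /= e1] _] [[_ /= e2] _]].
  by have : (1 : R) = - 1 := etrans (esym e1) e2; lra.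
have mgood b : measurable (signs_event (upd b) k.+1 `&` good).
  by apply: measurableI => //; exact: measurable_signs_event.
apply: le_trans (_ : (P ((signs_event (upd true) k.+1 `&` good) `|`
    (signs_event (upd false) k.+1 `&` good)) <= _)%E).
  rewrite measureU //; apply: le_trans (leeD (IHb mE' true) (IHb mE' false)).
  rewrite -EFinD lee_fin !sumS dropk /= mul1r mulN1r exprS.
  by rewrite le_eqVlt; apply/orP; left; apply/eqP; field.
apply: le_measure; rewrite ?inE.
- exact: measurableU.
- by apply: measurableI => //; exact: measurable_signs_event.
- by rewrite !eventS => w [[[? _] ?]|[[? _] ?]].
Qed.

End SignTuples.
Theorem theorem5p2 (R : realType) (d : measure_display) (T : measurableType d)
    (P : probability T R) (n : nat) (a : 'I_n -> R)
    (eps : 'I_n -> {RV P >-> R})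
    (a_noninc : forall i j : 'I_n, (i <= j)%N -> a j <= a i)
    (a_pos : forall i : 'I_n, 0 < a i)
    (a_var1 : \sum_(i < n) a i ^+ 2 = 1)
    (eps_indep : mutually_independent eps)
    (eps_sign : forall i : 'I_n, random_sign (eps i)) :
  ((29%:R / 64%:R)%:E <=
     P [set w | (1 / Num.sqrt 5%:R <= `|rademacher_sum a eps w|)%R])%E.
Proof.
have sqrt5 : 0 < Num.sqrt 5 :> R by rewrite sqrtr_gt0.
(* This factor moves the threshold [1 / sqrt 5] to [32] and the square sum [1] to [5 * 32 ^ 2]. *)
pose c i := 32 * Num.sqrt 5 * a i.
have c0 i : 0 < c i by rewrite !mulr_gt0.
have goodE : [set w | 1 / Num.sqrt 5%:R <= `|rademacher_sum a eps w|] =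
    [set w | 32 <= `|\sum_(i < n) c i * eps i w|].
  have scaled w : \sum_(i < n) c i * eps i w = 32 * Num.sqrt 5 * rademacher_sum a eps w.
    by rewrite mulr_sumr; apply: eq_bigr => i _; rewrite mulrA.
  have scale0 : 0 <= 32 * Num.sqrt 5 :> R by rewrite mulr_ge0 // ltW.
  have threshold x : (1 / Num.sqrt 5%:R <= x) = (32 <= 32 * Num.sqrt 5 * x :> R).
    by rewrite ler_pdivrMr // -mulrA -[X in _ = (X <= _)]mulr1 ler_pM2l // mulrC.
  by apply/seteqP; split=> w /=; rewrite threshold scaled normrM (ger0_norm scale0).
have sum_m : measurable_fun setT (fun w => \sum_(i < n) c i * eps i w).
  apply: measurable_sum => i.
  by apply: (measurableT_comp (measurable_realfun.mulrl_measurable (c i))).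
have good_m : measurable [set w | 32 <= `|\sum_(i < n) c i * eps i w|].
  have -> : [set w | 32 <= `|\sum_(i < n) c i * eps i w|] =
      (fun w => `|\sum_(i < n) c i * eps i w|) @^-1` `[32, +oo[.
    by apply/seteqP; split=> w /=; rewrite in_itv /= andbT.
  rewrite -[X in measurable X]setTI; apply: (measurableT_comp _ sum_m) => //.
have bound : avg (window 32) [seq c i | i <- enum 'I_n] 0 <= 35 / 64.
  apply: avg_window_bound.
  - rewrite sorted_map; apply: (@sub_sorted _ (fun i j : 'I_n => (i <= j)%N)).
      by move=> i j ij /=; rewrite ler_pM2l ?mulr_gt0 // a_noninc.
    by have := iota_sorted 0 n; rewrite -val_enum_ord sorted_map.
  - by move=> b /mapP[i _ ->]; exact: ltW.
  - rewrite big_map big_enum /= (eq_bigr (fun i => 5 * 32 ^+ 2 * a i ^+ 2)) => [|i _].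
      by rewrite -mulr_sumr a_var1 mulr1.
    by rewrite /c !exprMn sqr_sqrtr //; ring.
rewrite goodE.
(* For [k = 0] no sign is fixed, so the choice of [sg] is immaterial and the walk starts at 0. *)
have := prob_signs_sum_ge eps_indep eps_sign (fun=> true) (leq0n n) good_m.
rewrite expr0 mul1r drop0 big_pred0 // => prob_ge.
apply: le_trans (le_trans prob_ge _).
  by rewrite lee_fin; move: bound; lra.
apply: le_measure; last exact: subIsetr.
  by rewrite inE; apply: measurableI => //; exact: measurable_signs_event.
by rewrite inE.
Qed.
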